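(* Let $c\ne0$ and assume: (i) $E$ and $S$ are $C^{R+1}$ smooth; (ii) for all $u,v\in\mathbb R^d$, either $\nabla_vE(u,v)=0$, or $\nabla_v^2E(u,v)$ is invertible, where $\nabla_v^2E$ is the Hessian with respect to the variable $v$. Let $u\in C^R_b(\mathbb R,\mathbb R^d)$ be a solution, bounded in the $C^{R-1}_b(\mathbb R,\mathbb R^d)$-norm, of $$-\partial_x\nabla_vE(u,u')+\nabla_uE(u,u')+DS(u)^T\,K*S(u)=c\,\Gamma(u)u'.$$ Then both $\alpha(u)$ and $\omega(u)$ are nonempty and consist solely of constant functions. Furthermore, $\alpha(u)\cap\omega(u)=\emptyset$, unless $u$ is itself constant.
   Context: $\mathcal M(\mathbb R^d)$ denotes real $d\times d$ matrices. The kernel $K:\mathbb R\to\mathcal M(\mathbb R^d)$ satisfies $K(r)=K(-r)$, $K(r)=K(r)^T$, $K\in L^1(\mathbb R,\mathcal M(\mathbb R^d))$, and $\int_{\mathbb R}(1+|r|)\|K(r)\|\,dr<\infty$. $S\in C^2(\mathbb R^d,\mathbb R^d)$, $E=E(u,v)\in C^2(\mathbb R^d\times\mathbb R^d,\mathbb R)$, and $K*S(u)(x)=\int_{\mathbb R}K(x-y)S(u(y))\,dy$. $\Gamma\in C^0_b(\mathbb R^d,\mathcal M(\mathbb R^d))$ (bounded continuous) takes its values in the cone of positive definite $d\times d$ matrices. Set $R=1$ if $\nabla_vE\equiv0$ and $R=2$ otherwise. $C^k_b(\mathbb R,\mathbb R^d)$ is the space of $C^k$ functions which are uniformly bounded together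 with their first $k$ derivatives, and $C^R_{\rm loc}(\mathbb R,\mathbb R^d)$ is the space of $C^R$ functions with the topology of uniform convergence on compact sets of the function and its first $R$ derivatives. The shift is $\phi_\tau u(x)=u(x+\tau)$. The limit sets are those of the shift dynamics on $C^R_{\rm loc}(\mathbb R,\mathbb R^d)$: $\alpha(u)$ (resp. $\omega(u)$) is the set of all limits in $C^R_{\rm loc}(\mathbb R,\mathbb R^d)$ of sequences $\phi_{\tau_n}u$ with $\tau_n\to-\infty$ (resp. $\tau_n\to+\infty$).
   Formalization: Hypothesis (ii) is taken globally: either ∇_vE vanishes identically, or ∇_v²E(u,v) is invertible for all u,v; with the alternative allowed to vary from point to point, the limit sets can be empty in C^2_loc. *)

(* Defs.v *)
From mathcomp Require Import all_boot all_order all_algebra.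
From mathcomp Require Import all_classical all_reals all_analysis.
Set Implicit Arguments.
Unset Strict Implicit.
Unset Printing Implicit Defensive.
Import Order.TTheory GRing.Theory Num.Theory.
Import numFieldNormedType.Exports.
Local Open Scope ring_scope.
Local Open Scope classical_set_scope.

(* Vectors of R^d are columns, so that matrices act on the left. *)

Section smoothness.
Context {R : realType}.

(* On a finite-dimensional V, continuity of x |-> 'd f x v for each fixed v is
   continuity of x |-> 'd f x in operator norm, so this is the usual C^k. *)
Fixpoint Ck {V W : normedModType R} (k : nat) (f : V -> W) : Prop :=
  if k is k'.+1 then
    (forall x, differentiable f x) /\ (forall v, Ck k' (fun x => 'd f x v))
  else continuous f.

Context {d : nat}.
Implicit Types u g : R -> 'cV[R]_d.

Definition Ck_curve (k : nat) u : Prop :=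
  (forall j, (j < k)%N -> forall x, derivable u^`(j) x 1) /\ continuous u^`(k).

Definition Ckb_curve (k : nat) u : Prop :=
  Ck_curve k u /\
  (forall j, (j <= k)%N -> exists M : R, forall x, `|u^`(j) x| <= M).

Definition cvg_Ckloc (k : nat) (f : nat -> R -> 'cV[R]_d) g : Prop :=
  forall j, (j <= k)%N ->
    {family compact, (fun n => (f n)^`(j)) @ \oo --> g^`(j)}.

Definition phi (tau : R) u : R -> 'cV[R]_d := fun x => u (x + tau).

Definition alpha_limit (k : nat) u : set (R -> 'cV[R]_d) :=
  [set g | Ck_curve k g /\
    exists tau : nat -> R, tau @ \oo --> -oo /\
      cvg_Ckloc k (fun n => phi (tau n) u) g].

Definition omega_limit (k : nat) u : set (R -> 'cV[R]_d) :=
  [set g | Ck_curve k g /\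
    exists tau : nat -> R, tau @ \oo --> +oo /\
      cvg_Ckloc k (fun n => phi (tau n) u) g].

Definition constant_curve g : Prop := exists a, forall x, g x = a.

End smoothness.

Section calculus.
Context {R : realType} {d : nat}.
Implicit Types (f : 'cV[R]_d -> R) (F : 'cV[R]_d -> 'cV[R]_d).
Implicit Types (E : 'cV[R]_d -> 'cV[R]_d -> R).

Definition grad f (p : 'cV[R]_d) : 'cV[R]_d :=
  \col_i 'D_(delta_mx i 0) f p.

Definition jac F (p : 'cV[R]_d) : 'M[R]_d :=
  \matrix_(i, j) ('D_(delta_mx j 0) F p) i 0.

Definition grad_u E (u v : 'cV[R]_d) : 'cV[R]_d := grad (fun w => E w v) u.
Definition grad_v E (u v : 'cV[R]_d) : 'cV[R]_d := grad (E u) v.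
Definition hess_v E (u v : 'cV[R]_d) : 'M[R]_d := jac (grad (E u)) v.

Definition eq_order E : nat :=
  if `[< forall u v, grad_v E u v = 0 >] then 1%N else 2%N.

(* No symmetry is imposed: this covers both conventions for real matrices. *)
Definition posdef (A : 'M[R]_d) : Prop :=
  forall v : 'cV[R]_d, v != 0 -> 0 < (v^T *m A *m v) 0 0.

Definition kconv (K : R -> 'M[R]_d) (w : R -> 'cV[R]_d) (x : R) : 'cV[R]_d :=
  \col_i \int[lebesgue_measure]_y ((K (x - y) *m w y) i 0).

End calculus.

(* Main.v *)
Require Import Defs.
From mathcomp Require Import all_boot all_order all_algebra.
From mathcomp Require Import all_classical all_reals all_analysis.
From mathcomp Require Import measurable_realfun.
From mathcomp Require Import ring lra.
Import Order.TTheory GRing.Theory Num.Theory.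
Import numFieldNormedType.Exports.
Local Open Scope ring_scope.
Local Open Scope classical_set_scope.

(** The equation carries a Lyapunov function.  Pair it with [u'].  The local terms
    become the derivative of the energy [E(u, u') - grad_v E(u, u') . u'], and the
    right-hand side becomes [c] times the dissipation [u'^T Gamma(u) u'], which has
    a constant sign.  The nonlocal term becomes [w' . (K * w)] with [w = S(u)], and
    this is an exact derivative too: for an even scalar kernel [k], the function
      [int_r k(r) (a(x) b(x - r) + int_(x - r)^x b'(s) a(s + r) ds)]
    has derivative [a' (k * b) + b' (k * a)] ([nonlocal_energy_derive]), and half
    the sum of these over the entries of the symmetric matrix [K] has derivative
    [w' . (K * w)].  The inner integral grows like [|r|], so the first moment of
    [K] is what makes this nonlocal energy bounded.

    Divided by [c], the total energy is a bounded nondecreasing function whose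
    derivative is the dissipation ([lyapunov_derive], [lyapunov_bounded]), so it
    converges at both ends of the line.  By Barbalat's lemma ([barbalat]) the
    dissipation tends to [0] there.  The curve [u] stays in a compact set, on which
    the dissipation controls [u'] ([cvg0_of_positive]), so [u'] tends to [0].  When
    the equation is of second order, Barbalat's lemma applied to [u'] shows that
    [u''] tends to [0].  The uniform continuity that this requires comes from the
    equation, which expresses the derivative of highest order as a continuous
    function of bounded Lipschitz quantities ([top_derivative_unif_continuous]).

    Limits of translates therefore have zero derivative, so they are constant; they
    exist because [u] clusters at some [a] along each end and hardly moves on
    bounded windows there ([end_limit_nonempty], [end_limit_constant]).  Finally, if
    the translates converge to the constant [a] at an end, then the Lyapunov function
    tends to a value that depends on [a] only ([lyapunov_cvg]).  If both ends share
    [a], this monotone function has equal limits at both ends, so it is constant;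
    the dissipation vanishes, and so does [u'] ([homoclinic_constant]). *)

Set Implicit Arguments.
Unset Strict Implicit.
Unset Printing Implicit Defensive.

(** * Mean value inequalities and primitives on the line *)

Lemma is_derive_continuous (R : realType) (V : normedModType R) (f : R -> V)
    (x : R) (l : V) :
  is_derive x 1 f l -> {for x, continuous f}.
Proof.
by move=> [df _]; apply/differentiable_continuous/derivable1_diffP.
Qed.

Lemma mean_value (R : realType) (f f' : R -> R) (x y : R) :
  (forall t : R, is_derive t 1 f (f' t)) ->
  exists2 z, x <= z <= y \/ y <= z <= x & f y - f x = f' z * (y - x).
Proof.
move=> df.
have cf a b : {within `[a, b], continuous f}.
  by apply: continuous_subspaceT => t; exact: (is_derive_continuous (df t)).
have [xy|/ltW yx] := leP x y.
  have [z + ->] := @MVT_segment R f f' x y xy (fun t _ => df t) (cf x y).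
  by rewrite in_itv/= => zxy; exists z => //; left.
have [z + fE] := @MVT_segment R f f' y x yx (fun t _ => df t) (cf y x).
rewrite in_itv/= => zxy; exists z; first by right.
by rewrite -[LHS]opprB fE -mulrN opprB.
Qed.

Lemma derive_bound_lip (R : realType) (f f' : R -> R) (M : R) :
  (forall t : R, is_derive t 1 f (f' t)) -> (forall t, `|f' t| <= M) ->
  forall x y, `|f y - f x| <= M * `|y - x|.
Proof.
move=> df bf x y; have [z _ ->] := mean_value x y df.
by rewrite normrM ler_wpM2r.
Qed.

Lemma derive_ge0_homo (R : realType) (f f' : R -> R) :
  (forall t : R, is_derive t 1 f (f' t)) -> (forall t, 0 <= f' t) ->
  {homo f : x y / x <= y}.
Proof.
move=> df f0 x y xy; have [z _ fE] := mean_value x y df.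
by rewrite -subr_ge0 fE mulr_ge0// subr_ge0.
Qed.

Lemma derive_eq0_const (R : realType) (f f' : R -> R) :
  (forall t : R, is_derive t 1 f (f' t)) -> (forall t, f' t = 0) ->
  forall x y, f x = f y.
Proof.
move=> df f0 x y; have [z _ /eqP] := mean_value y x df.
by rewrite f0 mul0r subr_eq0 => /eqP.
Qed.

(** Integrals from base points far to the left differ by constants, so that, once
    normalised at [0], they patch together to a primitive on the whole line. *)
Lemma exists_primitive (R : realType) (f : R -> R) : continuous f ->
  exists P : R -> R, forall x : R, is_derive x 1 P (f x).
Proof.
move=> cf.
have fi (a b : R) : lebesgue_measure.-integrable `[a, b] (EFin \o f).
  apply: continuous_compact_integrable; first exact: segment_compact.
  exact: continuous_subspaceT.
pose G a x := (\int[lebesgue_measure]_(t in `[a, x]) f t)%R.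
have dG a (x : R) : a < x -> is_derive x 1 (G a) (f x).
  move=> ax; have xx1 : x < x + 1 by rewrite ltrDl.
  have [d1 d2] := continuous_FTC1_closed xx1 (fi _ _) ax (cf x).
  by apply: DeriveDef; [exact: d1|rewrite -derive1E; exact: d2].
have GB a b x : a <= b -> b <= x -> G a x - G a b =
    (\int[lebesgue_measure]_(t in `]b, x]) f t)%R.
  by move=> ab bx; rewrite /G Rintegral_itvB.
have Gind a b x : a <= b -> b <= x -> G a x - G a b = G b x.
  move=> ab bx; rewrite GB// Rintegral_itv_obnd_cbnd//.
  by apply: integrableS (fi b x) => //; exact: subset_itv_oc_cc.
have GG (a b x : R) : a <= b -> b <= 0 -> b <= x -> G a x - G a 0 = G b x - G b 0.
  move=> ab b0 bx; rewrite -(Gind a b x)// -(Gind a b 0)//; ring.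
pose P (x : R) := G (- (`|x| + 1)) x - G (- (`|x| + 1)) 0.
exists P => x.
have PE (y : R) : `|y| <= `|x| + 1 ->
    P y = G (- (`|x| + 2)) y - G (- (`|x| + 2)) 0.
  move=> yx; have yy := lerNnormlW (lexx `|y|).
  rewrite /P (GG (- (`|x| + 2)) (- (`|y| + 1)))//; first by lra.
  by lra.
apply: (@near_eq_is_derive _ _ _
    (fun y => G (- (`|x| + 2)) y - G (- (`|x| + 2)) 0)).
  near=> y; rewrite PE//.
  have yx : `|y - x| <= 1.
    by near: y; apply/nbhs_ballP; exists 1 => //= y; rewrite /ball/= distrC => /ltW.
  have := ler_normD (y - x) x; rewrite subrK; lra.
rewrite -[f x]subr0.
apply: (@is_deriveB _ _ _ (G (- (`|x| + 2))) (cst (G (- (`|x| + 2)) 0))).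
by apply: dG; have := lerNnormlW (lexx `|x|); lra.
Unshelve. all: by end_near. Qed.

(** * Convolution with kernels of finite first moment *)

Section reflection.
Context {R : realType}.
Local Notation mu := (@lebesgue_measure R).

Let reflect (x : R) : measurableTypeR R -> measurableTypeR R := fun y => x - y.

Let measurable_reflect x : measurable_fun setT (reflect x).
Proof. by apply: measurable_funD => //; exact: measurable_oppr. Qed.

Lemma lebesgue_measure_reflect (x : R) (A : set (measurableTypeR R)) :
  measurable A -> pushforward mu (reflect x) A = mu A.
Proof.
move=> mA; apply/esym.
pose push : {measure set (measurableTypeR R) -> \bar R} :=
  pushforward mu (reflect x).
apply: (@lebesgue_measure_unique R (push (measurable_reflect x))) mA.
move=> _ [[a b]] _ <-.
rewrite /push/= /pushforward/=.
have -> : reflect x @^-1` `]a, b] = `[x - b, x - a[%classic.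
  apply/seteqP; split => y; rewrite /reflect /= !in_itv/= => /andP[h1 h2];
    by apply/andP; split; lra.
rewrite !lebesgue_measure_itv/= !lte_fin ltrD2l ltrN2.
by case: ifP => // _; rewrite -!EFinB; congr EFin; lra.
Qed.

Lemma integrable_reflect (f : R -> R) (x : R) :
  mu.-integrable setT (EFin \o f) ->
  mu.-integrable setT (fun y => (f (x - y))%:E).
Proof.
move=> /integrableP[mf foo]; apply/integrableP; split.
  exact: (measurableT_comp mf (measurable_reflect x)).
rewrite [ltLHS](_ : _ = (\int[mu]_y `|(EFin \o f) y|)%E)//.
transitivity (\int[pushforward mu (reflect x)]_y `|(EFin \o f) y|)%E.
  rewrite ge0_integral_pushforward//.
  exact: measurableT_comp.
by apply: eq_measure_integral => A mA _; exact: lebesgue_measure_reflect.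
Qed.

Lemma Rintegral_reflect (f : R -> R) (x : R) :
  mu.-integrable setT (EFin \o f) ->
  (\int[mu]_y f (x - y) = \int[mu]_y f y)%R.
Proof.
move=> fi; congr fine.
transitivity (\int[pushforward mu (reflect x)]_y (EFin \o f) y)%E.
  rewrite integral_pushforward//.
  - by case/integrableP : fi.
  - exact: integrable_reflect.
by apply: eq_measure_integral => A mA _; exact: lebesgue_measure_reflect.
Qed.

End reflection.

Definition moment {R : realType} (k : R -> R) : R :=
  (\int[lebesgue_measure]_r ((1 + `|r|) * `|k r|))%R.

Definition finite_moment {R : realType} (k : R -> R) : Prop :=
  measurable_fun setT k /\
  lebesgue_measure.-integrable setT (fun r => ((1 + `|r|) * `|k r|)%:E).

Definition conv {R : realType} (k b : R -> R) (x : R) : R :=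
  (\int[lebesgue_measure]_y (k (x - y) * b y))%R.

Lemma measurable_comp_reflect {R : realType} (b : R -> R) (x : R) :
  measurable_fun setT b -> measurable_fun setT (fun r : R => b (x - r)).
Proof.
move=> mb; apply: measurableT_comp => //.
by apply: measurable_funD => //; exact: measurable_oppr.
Qed.

Section finite_moment.
Context {R : realType} (k : R -> R) (mk : finite_moment k).
Local Notation mu := (@lebesgue_measure R).

Lemma integrable_moment (g : R -> R) (C : R) :
  measurable_fun setT g -> (forall r, `|g r| <= C * (1 + `|r|)) ->
  mu.-integrable setT (fun r => (k r * g r)%:E).
Proof.
have [mf mi] := mk => mg gC.
apply: (@le_integrable _ _ _ mu _ _ _ (fun r => C%:E * ((1 + `|r|) * `|k r|)%:E)%E) => //.
- by apply/measurable_EFinP; exact: measurable_funM.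
- move=> r _; rewrite -EFinM !abse_EFin lee_fin.
  have -> : `|C * ((1 + `|r|) * `|k r|)| = `|C| * (1 + `|r|) * `|k r|.
    by rewrite !normrM normr_id (ger0_norm (addr_ge0 _ _))// mulrA.
  rewrite normrM mulrC ler_wpM2r// (le_trans (gC r))//.
  by rewrite ler_wpM2r ?addr_ge0// ler_norm.
- exact: integrableZl.
Qed.

Lemma norm_Rintegral_moment (g : R -> R) (C : R) :
  measurable_fun setT g -> (forall r, `|g r| <= C * (1 + `|r|)) ->
  `|\int[mu]_r (k r * g r)|%R <= C * moment k.
Proof.
have [mf mi] := mk => mg gC.
have i1 := integrable_moment mg gC.
apply: (le_trans (le_normr_Rintegral _ i1)) => //.
rewrite -RintegralZl//; apply: le_Rintegral => //.
- exact: integrable_abse i1.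
- rewrite [X in _.-integrable _ X](_ : _ = fun r => C%:E * ((1 + `|r|) * `|k r|)%:E)%E.
    exact: integrableZl.
  by apply/funext => r /=; rewrite -EFinM.
- move=> r _; rewrite normrM mulrC mulrA ler_wpM2r//.
Qed.

Lemma moment_ge0 : 0 <= moment k.
Proof. by apply: Rintegral_ge0 => r _; rewrite mulr_ge0// addr_ge0. Qed.

(** Reflecting the variable moves the shift from the kernel, which is merely
    integrable, to the regular factor. *)
Lemma convE (b : R -> R) (C : R) (x : R) :
  measurable_fun setT b -> (forall r, `|b r| <= C) ->
  conv k b x = (\int[mu]_r (k r * b (x - r)))%R.
Proof.
move=> mb bC.
have C0 : 0 <= C by apply: le_trans (bC 0).
have mbx := measurable_comp_reflect x mb.
rewrite /conv -[RHS](@Rintegral_reflect _ (fun r => k r * b (x - r)) x).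
  by apply: eq_Rintegral => y _ /=; rewrite subKr.
apply: (@integrable_moment (fun r => b (x - r)) C) => // r.
by rewrite (le_trans (bC _))// ler_peMr// lerDl.
Qed.

Lemma conv_bounded (b : R -> R) (C : R) (x : R) :
  measurable_fun setT b -> (forall r, `|b r| <= C) ->
  `|conv k b x| <= C * moment k.
Proof.
move=> mb bC; have C0 : 0 <= C by apply: le_trans (bC 0).
rewrite (convE _ mb bC); apply: norm_Rintegral_moment.
  exact: measurable_comp_reflect.
by move=> r; rewrite (le_trans (bC _))// ler_peMr// lerDl.
Qed.

Lemma conv_lipschitz (b : R -> R) (C L : R) (x y : R) :
  continuous b -> (forall r, `|b r| <= C) ->
  (forall r s, `|b r - b s| <= L * `|r - s|) ->
  `|conv k b x - conv k b y| <= L * moment k * `|x - y|.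
Proof.
move=> cb bC bL; have C0 : 0 <= C by apply: le_trans (bC 0).
have mb : measurable_fun setT b by exact: continuous_measurable_fun.
have mbx z := measurable_comp_reflect z mb.
have bC1 z r : `|b (z - r)| <= C * (1 + `|r|).
  by rewrite (le_trans (bC _))// ler_peMr// lerDl.
rewrite !(convE _ mb bC) -RintegralB//; try exact: integrable_moment.
under eq_Rintegral do rewrite -mulrBr.
rewrite mulrAC; apply: norm_Rintegral_moment.
  exact: measurable_funB.
move=> r; have -> : x - y = (x - r) - (y - r) by ring.
have h := bL (x - r) (y - r).
by rewrite (le_trans h)// ler_peMr ?lerDl// (le_trans _ h).
Qed.

End finite_moment.

(** * The nonlocal energy *)

Lemma is_derive_shift (R : realType) (f f' : R -> R) (r x : R) :
  (forall t : R, is_derive t 1 f (f' t)) ->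
  is_derive x 1 (fun y : R => f (y + r)) (f' (x + r)).
Proof.
move=> df; rewrite -[f' _]mulr1.
have d1 : is_derive x 1 (fun y : R => y + r) (1 + 0).
  exact: (@is_deriveD _ _ _ id (cst r)).
rewrite addr0 in d1; exact: (@is_derive1_comp R f _ x _ _ (df _) d1).
Qed.

Section nonlocal_potential.
Context {R : realType} (k a b a' b' : R -> R) (C : R).
Context (mk : finite_moment k) (k_even : forall r, k r = k (- r)).
Context (da : forall x : R, is_derive x 1 a (a' x)).
Context (db : forall x : R, is_derive x 1 b (b' x)).
Context (cb' : continuous b').
Context (aC : forall x, `|a x| <= C) (bC : forall x, `|b x| <= C).
Context (a'C : forall x, `|a' x| <= C) (b'C : forall x, `|b' x| <= C).

Let C_ge0 : 0 <= C. Proof. exact: le_trans (aC 0). Qed.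
Let ca : continuous a. Proof. by move=> x; exact: is_derive_continuous. Qed.
Let cb : continuous b. Proof. by move=> x; exact: is_derive_continuous. Qed.
Let a_lip : forall x y, `|a y - a x| <= C * `|y - x|.
Proof. exact: derive_bound_lip. Qed.

Let flux_continuous (r : R) : continuous (fun s => b' s * a (s + r)).
Proof.
move=> x; apply: cvgM; first exact: cb'.
apply: (@continuous_comp _ _ _ (fun s => s + r) a); last exact: ca.
by apply: cvgD; [exact: cvg_id|exact: cvg_cst].
Qed.

(** Writing the integral of [b' s * a (s + r)] for [s] from [x - r] to [x] as a
    difference of values of a primitive treats both signs of [r] at once. *)
Let flux_primitive : {P : R -> R -> R |
  forall r x : R, is_derive x 1 (P r) (b' x * a (x + r))}.
Proof.
have /choice[P dP] : forall r : R, exists Pr : R -> R,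
    forall x : R, is_derive x 1 Pr (b' x * a (x + r)).
  by move=> r; exact: exists_primitive (@flux_continuous r).
by exists P.
Qed.

Let P := sval flux_primitive.
Let dP : forall r x : R, is_derive x 1 (P r) (b' x * a (x + r)).
Proof. exact: svalP flux_primitive. Qed.

Let density (x r : R) : R := a x * b (x - r) + (P r x - P r (x - r)).

Let density_bound x r : `|density x r| <= C ^+ 2 * (1 + `|r|).
Proof.
rewrite mulrDr mulr1 (le_trans (ler_normD _ _))// lerD//.
  by rewrite normrM expr2 ler_pM.
have [z _ ->] := mean_value (x - r) x (dP r).
by rewrite subKr normrM ler_wpM2r// normrM expr2 ler_pM.
Qed.

(** The shifted term [b' (x - r) * a x] occurs in the derivative of either summand,
    with opposite signs. *)
Let density_derive (r x : R) : is_derive x 1 (density ^~ r)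
  (a' x * b (x - r) + b' x * a (x + r)).
Proof.
have dS := is_derive_shift (- r) x (dP r).
have dB := is_derive_shift (- r) x db.
have -> : a' x * b (x - r) + b' x * a (x + r) =
  (a x *: b' (x - r) + b (x - r) *: a' x) +
  (b' x * a (x + r) - b' (x - r) * a (x - r + r)).
  by rewrite subrK /GRing.scale/=; ring.
apply: (@is_deriveD _ _ _ (a * (fun y => b (y - r))) (P r - (fun y => P r (y - r)))).
  exact: is_deriveM.
exact: is_deriveB.
Qed.

Let density_continuous (x : R) : continuous (density x).
Proof.
move=> r0; apply: cvgD.
  apply: cvgM; first exact: cvg_cst.
  apply: (@continuous_comp _ _ _ (fun r => x - r) b); last exact: cb.
  by apply: cvgB; [exact: cvg_cst|exact: cvg_id].
apply/cvgrPdist_le => e e0.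
have A0 : 0 < C ^+ 2 * `|r0| + C ^+ 2 + 1.
  by rewrite ltr_wpDl// addr_ge0 ?mulr_ge0 ?sqr_ge0.
have d0 : 0 < e / 2 / (C ^+ 2 * `|r0| + C ^+ 2 + 1) by rewrite divr_gt0// divr_gt0.
near=> r.
(* Vary [r] first in the integrand, which [D] does, and then in the lower bound
   [x - r] of the integral. *)
pose D y : R := P r y - P r0 y.
have dD (y : R) : is_derive y 1 D (b' y * (a (y + r) - a (y + r0))).
  rewrite mulrBr; exact: (@is_deriveB _ _ _ (P r) (P r0)).
have DC y : `|b' y * (a (y + r) - a (y + r0))| <= C ^+ 2 * `|r - r0|.
  rewrite normrM expr2 -mulrA ler_pM// (le_trans (a_lip _ _))//.
  by rewrite opprD addrACA subrr add0r.
have h1 := derive_bound_lip dD DC (x - r0) x.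
have PC y : `|b' y * a (y + r)| <= C ^+ 2 by rewrite normrM expr2 ler_pM.
have h2 := derive_bound_lip (dP r) PC (x - r) (x - r0).
have -> : P r0 x - P r0 (x - r0) - (P r x - P r (x - r)) =
    - (D x - D (x - r0)) - (P r (x - r0) - P r (x - r)).
  by rewrite /D; ring.
rewrite (le_trans (ler_normB _ _))// normrN.
have -> : e = e / 2 + e / 2 by rewrite -splitr.
have {}h1 : `|D x - D (x - r0)| <= C ^+ 2 * `|r0| * `|r - r0|.
  by rewrite (le_trans h1)// subKr mulrAC.
have {}h2 : `|P r (x - r0) - P r (x - r)| <= C ^+ 2 * `|r - r0|.
  by rewrite (le_trans h2)// opprB addrC addrA subrK.
have rr : `|r - r0| <= e / 2 / (C ^+ 2 * `|r0| + C ^+ 2 + 1).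
  near: r; apply/nbhs_ballP.
  exists (e / 2 / (C ^+ 2 * `|r0| + C ^+ 2 + 1)); first exact: d0.
  by move=> r; rewrite /ball/= distrC => /ltW.
move: rr; rewrite ler_pdivlMr// => rr.
have c2 : 0 <= C ^+ 2 by exact: sqr_ge0.
have n0 : 0 <= `|r - r0| by [].
have n1 : 0 <= C ^+ 2 * `|r0| * `|r - r0| by rewrite !mulr_ge0.
have n2 : 0 <= C ^+ 2 * `|r - r0| by rewrite !mulr_ge0.
by rewrite lerD//; [apply: (le_trans h1)|apply: (le_trans h2)]; nra.
Unshelve. all: by end_near. Qed.

Local Notation mu := (@lebesgue_measure R).

Let density_integrable x : mu.-integrable setT (fun r => (k r * density x r)%:E).
Proof.
apply: (integrable_moment mk (C := C ^+ 2)); last exact: density_bound.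
exact: continuous_measurable_fun.
Qed.

Definition nonlocal_energy (x : R) : R := (\int[mu]_r (k r * density x r))%R.

Lemma nonlocal_energy_bounded x : `|nonlocal_energy x| <= C ^+ 2 * moment k.
Proof.
apply: norm_Rintegral_moment => //; exact: continuous_measurable_fun.
Qed.

(** The term [a (x + r)] in the derivative of the density yields [conv k a] because
    [k] is even. *)
Lemma nonlocal_energy_derive (x : R) :
  is_derive x 1 nonlocal_energy (a' x * conv k b x + b' x * conv k a x).
Proof.
have dkd (r y : R) : is_derive y 1 (fun t => k r * density t r)
    (k r * (a' y * b (y - r) + b' y * a (y + r))).
  exact: (@is_deriveZ _ _ _ (density ^~ r) (k r)).
have d1E y r : partial1of2 (fun t r => k r * density t r) y r =
    k r * (a' y * b (y - r) + b' y * a (y + r)).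
  by rewrite partial1of2E derive_val.
have ma : measurable_fun setT a by exact: continuous_measurable_fun.
have mb : measurable_fun setT b by exact: continuous_measurable_fun.
have abC y r : `|a' y * b (y - r) + b' y * a (y + r)| <= 2 * C ^+ 2 * (1 + `|r|).
  have h : `|a' y * b (y - r) + b' y * a (y + r)| <= 2 * C ^+ 2.
    rewrite (le_trans (ler_normD _ _))// !normrM mulr_natl mulr2n.
    by rewrite expr2 lerD// ler_pM.
  by rewrite (le_trans h)// ler_peMr ?lerDl// mulr_ge0// sqr_ge0.
have xI : `]x - 1, x + 1[%classic x.
  by rewrite /= in_itv/= ltrBlDr ltrDl ltr01.
pose G r : R := 2 * C ^+ 2 * ((1 + `|r|) * `|k r|).
have dI y r : `]x - 1, x + 1[%classic y -> setT r ->
    derivable (fun t => k r * density t r) y 1.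
  by move=> _ _; case: (dkd r y).
have G0 r : 0 <= G r by rewrite !mulr_ge0 ?sqr_ge0 ?addr_ge0.
have iG : mu.-integrable setT (EFin \o G).
  have -> : EFin \o G = (fun r => (2 * C ^+ 2)%:E * ((1 + `|r|) * `|k r|)%:E)%E.
    by apply/funext => r /=; rewrite -EFinM.
  by apply: integrableZl => //; case: mk.
have GC y r : `]x - 1, x + 1[%classic y -> setT r ->
    `|partial1of2 (fun t r => k r * density t r) y r| <= G r.
  by move=> _ _; rewrite d1E normrM mulrC /G mulrA ler_wpM2r.
apply: DeriveDef.
  exact: (derivable_under_integral measurableT xI (fun y _ => density_integrable y) dI G0 iG GC).
rewrite -derive1E.
rewrite (differentiation_under_integral measurableT xI (fun y _ => density_integrable y) dI G0 iG GC).
under eq_Rintegral do rewrite d1E.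
have C1 (g : R -> R) r : (forall r, `|g r| <= C) -> `|g r| <= C * (1 + `|r|).
  by move=> gC; rewrite (le_trans (gC _))// ler_peMr// lerDl.
have mbx := measurable_comp_reflect x mb.
have max : measurable_fun setT (fun r : R => a (x + r)).
  by apply: measurableT_comp => //; exact: measurable_funD.
have ib : mu.-integrable setT (fun r => (k r * b (x - r))%:E).
  by apply: (integrable_moment mk (C := C)) => // r; exact: (C1 (fun r => b (x - r))).
have ia : mu.-integrable setT (fun r => (k r * a (x + r))%:E).
  by apply: (integrable_moment mk (C := C)) => // r; exact: (C1 (fun r => a (x + r))).
have ia' : mu.-integrable setT (fun r => (k r * a (x - r))%:E).
  apply: (integrable_moment mk (C := C)) => [|r].
    exact: measurable_comp_reflect.
  exact: (C1 (fun r => a (x - r))).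
have iZ c (g : R -> R) : mu.-integrable setT (fun r => (g r)%:E) ->
    mu.-integrable setT (EFin \o (fun r => c * g r)).
  move=> ig; rewrite (_ : EFin \o _ = (fun r => c%:E * (g r)%:E)%E).
    exact: integrableZl.
  by apply/funext => r /=; rewrite EFinM.
have aE : conv k a x = (\int[mu]_r (k r * a (x + r)))%R.
  rewrite (convE mk _ (C := C))// -(Rintegral_reflect 0 ia').
  by apply: eq_Rintegral => r _; rewrite sub0r opprK -k_even.
rewrite aE (convE mk _ (C := C))// -!RintegralZl// -RintegralD//; last 2 first.
- exact: iZ.
- exact: iZ.
by apply: eq_Rintegral => r _; ring.
Qed.

(** By the mean value theorem the integral part of the density is [r] times a value
    of [b' * a] near [tau n], and [b'] vanishes there in the limit. *)
Let density_cvg (tau : nat -> R) (al be r : R) :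
  (forall t, a (tau n + t) @[n --> \oo] --> al) ->
  (forall t, b (tau n + t) @[n --> \oo] --> be) ->
  (forall L e : R, 0 < e ->
    \forall n \near \oo, forall t, `|t| <= L -> `|b' (tau n + t)| <= e) ->
  density (tau n) r @[n --> \oo] --> al * be.
Proof.
move=> aal bbe b'0; rewrite -[al * be]addr0; apply: cvgD.
  apply: cvgM; last exact: bbe (- r).
  by have := aal 0; under eq_fun do rewrite addr0.
apply/cvgrPdist_le => e e0.
have d0 : 0 < `|r| * C + 1 by rewrite ltr_wpDl// mulr_ge0.
have := b'0 `|r| _ (divr_gt0 e0 d0); apply: filterS => n nb'.
rewrite sub0r normrN.
have [z zr ->] := mean_value (tau n - r) (tau n) (dP r).
have zE : z = tau n + (z - tau n) by ring.
have {}nb' : `|b' z| <= e / (`|r| * C + 1).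
  rewrite zE; apply: nb'.
  have hr := ler_norm r; have hr' := lerNnormlW (lexx `|r|).
  by rewrite ler_norml; case: zr => /andP[z1 z2]; apply/andP; split; lra.
move: nb'; rewrite subKr !normrM ler_pdivlMr// => nb'.
have aC1 := aC (z + r).
have n1 : 0 <= `|a (z + r)| by [].
have n2 : 0 <= `|b' z| by [].
have n3 : 0 <= `|r| by [].
have n4 : `|b' z| * `|a (z + r)| * `|r| <= `|b' z| * (`|r| * C).
  by rewrite -mulrA ler_wpM2l// mulrC ler_wpM2l.
by rewrite (le_trans n4)// (le_trans _ nb')// ler_wpM2l// lerDl.
Qed.

Lemma nonlocal_energy_cvg (tau : nat -> R) (al be : R) :
  (forall t, a (tau n + t) @[n --> \oo] --> al) ->
  (forall t, b (tau n + t) @[n --> \oo] --> be) ->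
  (forall L e : R, 0 < e ->
    \forall n \near \oo, forall t, `|t| <= L -> `|b' (tau n + t)| <= e) ->
  nonlocal_energy (tau n) @[n --> \oo] --> (\int[mu]_r (k r * (al * be)))%R.
Proof.
move=> aal bbe b'0; have [mf mi] := mk.
have md n : measurable_fun setT (EFin \o (fun r => k r * density (tau n) r)).
  by case/integrableP : (density_integrable (tau n)).
have mlim : measurable_fun setT (EFin \o (fun r => k r * (al * be))).
  by apply/measurable_EFinP; exact: measurable_funM.
have ig : mu.-integrable setT (fun r => (C ^+ 2)%:E * ((1 + `|r|) * `|k r|)%:E)%E.
  exact: integrableZl.
have kd r : setT r -> (k r * density (tau n) r)%:E @[n --> \oo] -->
    (k r * (al * be))%:E.
  move=> _; apply: cvg_EFin; first exact: nearW.
  by apply: cvgM; [exact: cvg_cst|exact: density_cvg].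
have [||ilim _ h] := @dominated_convergence _ _ _ mu setT measurableT
    _ _ _ md mlim _ ig _.
- by apply: aeW => r; exact: kd.
- apply: aeW => r n _; rewrite -EFinM abse_EFin lee_fin normrM mulrC mulrA.
  by rewrite ler_wpM2r.
apply: fine_cvg; rewrite fineK//; exact: integrable_fin_num.
Qed.

End nonlocal_potential.

(** * Behaviour of functions along the two ends of the line *)

(** Two features shared by both ends of the line: their neighbourhoods absorb
    bounded shifts, and they have a countable basis, so that cluster points along
    them are reached by sequences. *)
Definition end_filter {R : realType} (F : set_system R) : Prop :=
  (forall (P : set R) (L : R), F P ->
     F [set x | forall t, `|t| <= L -> P (x + t)]) /\
  (exists A : nat -> set R, (forall n, F (A n)) /\
     forall P, F P -> exists N, forall n, (N <= n)%N -> A n `<=` P).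

Lemma end_filter_pinfty (R : realType) : end_filter (+oo : set_system R).
Proof.
split.
  move=> P L [M [Mr PM]]; exists (M + `|L|); split; first exact: num_real.
  move=> x Mx t tL; apply: PM.
  have := lerNnormlW (lexx `|t|); have := ler_norm L; lra.
exists (fun n => [set x : R | n%:R < x]); split.
  by move=> n; exists n%:R; split => //; exact: num_real.
move=> P [M [Mr PM]]; exists (Num.truncn `|M|).+1 => n nM x /= nx; apply: PM.
apply: le_lt_trans (ler_norm M) _; apply: lt_trans nx.
by apply: (lt_le_trans (truncnS_gt _)); rewrite ler_nat.
Qed.

Lemma end_filter_ninfty (R : realType) : end_filter (-oo : set_system R).
Proof.
split.
  move=> P L [M [Mr PM]]; exists (M - `|L|); split; first exact: num_real.
  move=> x Mx t tL; apply: PM.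
  have := ler_norm t; have := ler_norm L; lra.
exists (fun n => [set x : R | x < - n%:R]); split.
  by move=> n; exists (- n%:R); split => //; exact: num_real.
move=> P [M [Mr PM]]; exists (Num.truncn `|M|).+1 => n nM x /= nx; apply: PM.
apply: (lt_le_trans nx); apply: le_trans (lerNnormlW (lexx `|M|)).
rewrite lerN2; apply: ltW.
by apply: (lt_le_trans (truncnS_gt _)); rewrite ler_nat.
Qed.

Lemma unif_continuous_normP (R : realType) (V W : normedModType R) (f : V -> W) :
  unif_continuous f <-> forall e, 0 < e -> exists2 d, 0 < d &
    forall x y, `|x - y| < d -> `|f x - f y| < e.
Proof.
rewrite unif_continuousP; split => h e /h[d d0 hd]; exists d => //.
  by move=> x y xy; have := hd (x, y); rewrite -!ball_normE; exact.
by move=> x; rewrite -!ball_normE; exact: hd.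
Qed.

Lemma lipschitz_unif_continuous (R : realType) (V W : normedModType R)
    (f : V -> W) (L : R) :
  (forall x y, `|f x - f y| <= L * `|x - y|) -> unif_continuous f.
Proof.
move=> fL; apply/unif_continuous_normP => e e0.
have L0 : 0 < `|L| + 1 by rewrite ltr_wpDl.
exists (e / (`|L| + 1)); first by rewrite divr_gt0.
move=> x y; rewrite ltr_pdivlMr// => xy; apply: le_lt_trans (fL x y) _.
apply: le_lt_trans xy; rewrite mulrC ler_wpM2l//.
by have := ler_norm L; lra.
Qed.

(** Barbalat: over a short step on which [f'] varies little, [f] would increase by
    about the length of the step times [f' x], and this increment vanishes along the
    end since [f] converges. *)
Lemma barbalat (R : realType) (F : set_system R) (f f' : R -> R) (l : R) :
  ProperFilter F -> end_filter F ->
  (forall x : R, is_derive x 1 f (f' x)) -> unif_continuous f' ->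
  f x @[x --> F] --> l -> f' x @[x --> F] --> 0.
Proof.
move=> FF [wF _] df /unif_continuous_normP uf fl.
apply/cvgrPdist_le => e e0; have e2 : 0 < e / 2 by rewrite divr_gt0.
have [d d0 fd] := uf _ e2.
have d2 : 0 < d / 2 by rewrite divr_gt0.
have de : 0 < d / 2 * (e / 4) by rewrite mulr_gt0// divr_gt0.
move/cvgrPdist_le : fl => /(_ _ de)/(wF _ (d / 2)); apply: filterS => x fx.
rewrite sub0r normrN.
have h1 := fx 0; rewrite normr0 addr0 in h1.
have h2 := fx (d / 2); rewrite gtr0_norm// lexx in h2.
have [z zx fE] := mean_value x (x + d / 2) df.
have {fE} fE : f (x + d / 2) - f x = f' z * (d / 2) by rewrite fE; congr (_ * _); ring.
have zd : `|x - z| < d.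
  by rewrite ltr_norml; case: zx => /andP[z1 z2]; apply/andP; split; lra.
have h3 := fd _ _ zd.
have h4 : `|f' z| * (d / 2) <= d / 2 * (e / 2).
  rewrite -[X in _ * X <= _](gtr0_norm d2) -normrM -fE.
  have -> : f (x + d / 2) - f x = (l - f x) - (l - f (x + d / 2)) by ring.
  rewrite (le_trans (ler_normB _ _))//.
  have := h1 (ltW d2); have := h2 isT; lra.
rewrite mulrC ler_pM2l// in h4.
have := ler_normD (f' x - f' z) (f' z); rewrite subrK; lra.
Qed.

Lemma mx_norm_entry (R : realType) m n (M : 'M[R]_(m, n)) i j : `|M i j| <= `|M|.
Proof.
rewrite [leRHS]/Num.Def.normr/= mx_normrE.
exact: (le_bigmax _ (fun ij : 'I_m * 'I_n => `|M ij.1 ij.2|) (i, j)).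
Qed.

Lemma mx_norm_le (R : realType) m n (M : 'M[R]_(m, n)) (e : R) : 0 <= e ->
  (forall i j, `|M i j| <= e) -> `|M| <= e.
Proof.
move=> e0 Me; rewrite [leLHS]/Num.Def.normr/= mx_normrE.
by apply: bigmax_le => //= -[i j] _; exact: Me.
Qed.

Lemma mx_norm_lt (R : realType) m n (M : 'M[R]_(m, n)) (e : R) : 0 < e ->
  (forall i j, `|M i j| < e) -> `|M| < e.
Proof.
move=> e0 Me; rewrite [ltLHS]/Num.Def.normr/= mx_normrE.
by apply: bigmax_lt => //= -[i j] _; exact: Me.
Qed.

Lemma cvg_mxP (R : realType) (T : Type) (F : set_system T) {FF : Filter F} m n
    (f : T -> 'M[R]_(m, n)) (l : 'M[R]_(m, n)) :
  f x @[x --> F] --> l <-> forall i j, f x i j @[x --> F] --> l i j.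
Proof.
split=> [fl i j|fl].
  exact: (cvg_comp _ _ fl (@coord_continuous _ _ _ i j l)).
apply/cvgrPdist_le => e e0.
near=> x; apply: mx_norm_le; first exact: ltW.
move=> i j; rewrite !mxE; move: i j; near: x.
apply: filter_forall => i; apply: filter_forall => j.
by have /cvgrPdist_le := fl i j; exact.
Unshelve. all: by end_near. Qed.

Lemma is_derive_entry (R : realType) m n (f : R -> 'M[R]_(m, n)) (l : 'M[R]_(m, n))
    (x : R) (i : 'I_m) (j : 'I_n) :
  is_derive x 1 f l -> is_derive x 1 (fun y => f y i j) (l i j).
Proof.
move=> [df <-]; rewrite derive_mx// mxE.
by apply: DeriveDef => //; exact: (derivable_mxP f x 1).1.
Qed.

Lemma unif_continuous_mxP (R : realType) (V : normedModType R) m n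
    (f : V -> 'M[R]_(m, n)) :
  unif_continuous f <-> forall i j, unif_continuous (fun x => f x i j).
Proof.
split=> [/unif_continuous_normP uf i j|uf].
  apply/unif_continuous_normP => e /uf[d d0 fd]; exists d => // x y /fd.
  by apply: le_lt_trans; have := mx_norm_entry (f x - f y) i j; rewrite !mxE.
apply/unif_continuous_normP => e e0.
have : \forall d \near (0 : R)^'+, 0 < d /\ forall i j x y, `|x - y| < d ->
    `|f x i j - f y i j| < e.
  near=> d; split=> //; move=> i j; move: i j; near: d.
  apply: filter_forall => i; apply: filter_forall => j.
  have /unif_continuous_normP/(_ e e0)[d d0 fd] := uf i j.
  near=> d' => x y xy; apply: fd; apply: (lt_trans xy).
  by near: d'; exact: nbhs_right_lt.
move=> /filter_ex[d [d0 fd]]; exists d => // x y xy.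
by apply: mx_norm_lt => // i j; rewrite !mxE; exact: fd.
Unshelve. all: by end_near. Qed.

Lemma barbalat_mx (R : realType) (F : set_system R) m n (f f' : R -> 'M[R]_(m, n))
    (l : 'M[R]_(m, n)) :
  ProperFilter F -> end_filter F ->
  (forall x : R, is_derive x 1 f (f' x)) -> unif_continuous f' ->
  f x @[x --> F] --> l -> f' x @[x --> F] --> (0 : 'M[R]_(m, n)).
Proof.
move=> FF eF df uf /cvg_mxP fl; apply/cvg_mxP => i j; rewrite mxE.
apply: barbalat eF _ _ (fl i j); last exact: (unif_continuous_mxP f').1.
by move=> x; exact: is_derive_entry.
Qed.

(** * Compactness and uniform continuity *)

Lemma compact_cV_ball (R : realType) (d : nat) (M : R) :
  compact [set v : 'cV[R]_d | `|v| <= M].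
Proof.
have trc : continuous (fun v : 'rV[R]_d => v^T).
  move=> v; apply/(@cvg_mxP _ _ (nbhs v)) => i j; rewrite mxE.
  under eq_fun do rewrite mxE; exact: coord_continuous.
have trn (v : 'cV[R]_d) : `|v^T| = `|v|.
  apply/le_anti/andP; split; apply: mx_norm_le => // i j.
    by rewrite mxE; exact: mx_norm_entry.
  by have := mx_norm_entry v^T j i; rewrite mxE.
have -> : [set v : 'cV[R]_d | `|v| <= M] =
    (fun v : 'rV[R]_d => v^T) @` [set v : 'rV[R]_d | `|v| <= M].
  apply/seteqP; split => [v /= vM|_ [v /= vM <-]].
    by exists v^T; rewrite /= ?trn// trmxK.
  by rewrite -trn trmxK.
apply: continuous_compact; first exact: continuous_subspaceT.
apply: bounded_closed_compact.
  by exists M; split; [exact: num_real|move=> y My v /= /le_trans; apply; exact: ltW].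
apply: (@closed_comp _ _ (fun v : 'rV[R]_d => `|v|) [set y | y <= M]).
  by move=> v _; exact: norm_continuous.
exact: closed_le.
Qed.

Lemma compact_cV_ball2 (R : realType) (d : nat) (M : R) :
  compact [set p : 'cV[R]_d * 'cV[R]_d | `|p.1| <= M /\ `|p.2| <= M].
Proof. exact: compact_setX (@compact_cV_ball R d M) (@compact_cV_ball R d M). Qed.

(** Heine's argument: one modulus of continuity of [f] serves near all points of the
    compact set [A], also towards points outside [A]. *)
Lemma unif_continuous_comp_compact (R : realType) (U V W : normedModType R)
    (A : set V) (f : V -> W) (X : U -> V) :
  compact A -> continuous f -> (forall x, A (X x)) -> unif_continuous X ->
  unif_continuous (f \o X).
Proof.
move=> cA cf AX /unif_continuous_normP uX.
apply/unif_continuous_normP => e e0.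
have : \forall d \near (0 : R)^'+, A `<=` [set a | 0 < d /\
    forall y, `|a - y| < d -> `|f a - f y| < e].
  move/compact_near_coveringP : cA; apply => a Aa.
  have e2 : 0 < e / 2 by rewrite divr_gt0.
  have /cvgrPdist_lt/(_ _ e2)/nbhs_ballP[r /= r0 fr] := cf a.
  have r2 : 0 < r / 2 by rewrite divr_gt0.
  have near_a : \forall a' \near a, `|a - a'| < r / 2.
    by apply/nbhs_ballP; exists (r / 2) => //= y; rewrite -ball_normE.
  near=> a' d => /=; split; first by near: d; exact: nbhs_right_gt.
  move=> y a'y.
  have aa' : `|a - a'| < r / 2 by near: a'.
  have dr : d < r / 2 by near: d; exact: nbhs_right_lt.
  have h1 : `|f a - f a'| < e / 2.
    by apply: fr; rewrite -ball_normE/=; lra.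
  have h2 : `|f a - f y| < e / 2.
    apply: fr; rewrite -ball_normE/=.
    by have := ler_normD (a - a') (a' - y); rewrite addrA subrK; lra.
  have := ler_normB (f a - f y) (f a - f a').
  have -> : f a - f y - (f a - f a') = f a' - f y.
    by rewrite opprB addrC addrA subrK.
  lra.
move=> /filter_ex[d Ad]; have [d0 _] := Ad _ (AX 0).
have [r r0 Xr] := uX _ d0; exists r => // x y xy.
by have [_] := Ad _ (AX x); apply; exact: Xr.
Unshelve. all: by end_near. Qed.

Lemma bounded_comp_compact (R : realType) (U : Type) (V W : normedModType R)
    (A : set V) (f : V -> W) (X : U -> V) :
  compact A -> continuous f -> (forall x, A (X x)) ->
  exists M, forall x, `|f (X x)| <= M.
Proof.
move=> cA cf AX.
have : compact (f @` A).
  by apply: continuous_compact => //; exact: continuous_subspaceT.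
move=> /compact_bounded[M [Mr MA]]; exists (M + 1) => x.
by apply: MA; [rewrite ltrDl|exists (X x)].
Qed.

Lemma unif_continuous_pair (R : realType) (U V W : normedModType R)
    (f : U -> V) (g : U -> W) :
  unif_continuous f -> unif_continuous g -> unif_continuous (fun x => (f x, g x)).
Proof.
move=> /unif_continuous_normP uf /unif_continuous_normP ug.
apply/unif_continuous_normP => e e0.
have [r r0 fr] := uf _ e0; have [s s0 gs] := ug _ e0.
exists (Num.min r s); first by rewrite lt_min r0.
move=> x y; rewrite lt_min => /andP[xr xs].
by rewrite prod_normE/= gt_max fr// gs.
Qed.

Lemma end_cluster_sequence (R : realType) (F : set_system R) (d : nat)
    (u : R -> 'cV[R]_d) (M : R) :
  ProperFilter F -> end_filter F -> (forall x, `|u x| <= M) ->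
  exists (tau : nat -> R) (a : 'cV[R]_d),
    tau n @[n --> \oo] --> F /\ u (tau n) @[n --> \oo] --> a.
Proof.
move=> FF [_ [A [FA cA]]] uM.
have [a [_ ua]] : [set v : 'cV[R]_d | `|v| <= M] `&` cluster (u @ F) !=set0.
  by apply: compact_cV_ball; apply: nearW.
have /choice[tau tauP] : forall n : nat, exists x : R,
    A n x /\ `|a - u x| < n.+1%:R^-1.
  move=> n.
  have F1 : (u @ F) (u @` A n).
    by rewrite /fmap/=; apply: filterS (FA n) => x Ax; exists x.
  have [|_ [[x Ax <-] ux]] := ua _ (ball a n.+1%:R^-1) F1.
    by apply: nbhsx_ballx; rewrite invr_gt0.
  by exists x; split=> //; move: ux; rewrite -ball_normE.
exists tau, a; split.
  move=> P /cA[N AP]; exists N => // n /= Nn; apply: (AP n Nn).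
  by have [] := tauP n.
apply/cvgrPdist_lt => e e0; near=> n.
have [_ h] := tauP n; apply: (lt_trans h).
near: n; exact: near_infty_natSinv_lt (PosNum e0).
Unshelve. all: by end_near. Qed.

(** On a compact set where [e <= `|v|], a continuous function that is positive off
    [v = 0] is bounded below, so small values of it force [v] to be small. *)
Lemma cvg0_of_positive (R : realType) (F : set_system R) (d : nat)
    (Q : 'cV[R]_d * 'cV[R]_d -> R) (u v : R -> 'cV[R]_d) (M : R) :
  Filter F -> continuous Q -> (forall p, p.2 != 0 -> 0 < Q p) ->
  (forall x, `|u x| <= M) -> (forall x, `|v x| <= M) ->
  Q (u x, v x) @[x --> F] --> 0 -> v x @[x --> F] --> (0 : 'cV[R]_d).
Proof.
move=> FF cQ Q0 uM vM Qcvg; apply/cvgrPdist_lt => e e0.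
pose C := [set p : 'cV[R]_d * 'cV[R]_d | `|p.1| <= M /\ `|p.2| <= M] `&`
  [set p | e <= `|p.2|].
have cC : compact C.
  apply: compact_closedI; first exact: compact_cV_ball2.
  apply: (@closed_comp _ _ (fun p : 'cV[R]_d * 'cV[R]_d => `|p.2|) [set y | e <= y]).
    move=> p _; apply: (@continuous_comp _ _ _ snd (fun v : 'cV[R]_d => `|v|)).
      exact: cvg_snd.
    exact: norm_continuous.
  exact: closed_ge.
have Cuv x : e <= `|v x| -> C (u x, v x).
  by move=> ev; split => //; split => /=; [exact: uM|exact: vM].
have [C0|/set0P C0] := eqVneq C set0.
  near=> x; rewrite sub0r normrN ltNge; apply/negP => ev.
  by have := Cuv x ev; rewrite C0.
have [c Cc cmin] := compact_EVT_min C0 cC (continuous_subspaceT cQ).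
have Qc : 0 < Q c.
  apply: Q0; apply: contraTneq (e0) => c0; rewrite -leNgt.
  by move/set_mem: Cc => [_ /=]; rewrite c0 normr0.
move/cvgrPdist_lt : Qcvg => /(_ _ Qc); apply: filterS => x Qx.
rewrite sub0r normrN ltNge; apply/negP => ev.
have /mem_set/cmin := Cuv x ev.
move: Qx; rewrite sub0r normrN => Qx; apply/negP; rewrite -ltNge.
exact: le_lt_trans (ler_norm _) Qx.
Unshelve. all: by end_near. Qed.

(** * Continuity of matrix-valued expressions *)

Lemma continuous_mxP (R : realType) (T : topologicalType) m n
    (f : T -> 'M[R]_(m, n)) :
  continuous f <-> forall i j, continuous (fun x => f x i j).
Proof.
split=> [cf i j x|cf x]; first exact: (@cvg_mxP _ _ (nbhs x) _ _ _ _ _).1 (cf x) i j.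
by apply/(@cvg_mxP _ _ (nbhs x)) => i j; exact: cf.
Qed.

Lemma continuous_sum (R : realType) (T : topologicalType) (I : Type) (s : seq I)
    (P : pred I) (F : I -> T -> R) :
  (forall i, P i -> continuous (F i)) ->
  continuous (fun x => \sum_(i <- s | P i) F i x).
Proof. by apply: continuous_big; exact: add_continuous. Qed.

Lemma continuous_prod (R : realType) (T : topologicalType) (I : Type) (s : seq I)
    (P : pred I) (F : I -> T -> R) :
  (forall i, P i -> continuous (F i)) ->
  continuous (fun x => \prod_(i <- s | P i) F i x).
Proof. by apply: continuous_big; exact: mul_continuous. Qed.

Lemma continuous_mulmx (R : realType) (T : topologicalType) m n p
    (A : T -> 'M[R]_(m, n)) (B : T -> 'M[R]_(n, p)) :
  continuous A -> continuous B -> continuous (fun x => A x *m B x).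
Proof.
move=> /continuous_mxP cA /continuous_mxP cB; apply/continuous_mxP => i j.
rewrite (_ : (fun x => (A x *m B x) i j) = fun x => \sum_k A x i k * B x k j).
  by apply: continuous_sum => k _ x; apply: cvgM; [exact: cA|exact: cB].
by apply/funext => x; rewrite mxE.
Qed.

Lemma continuous_trmx (R : realType) (T : topologicalType) m n
    (A : T -> 'M[R]_(m, n)) : continuous A -> continuous (fun x => (A x)^T).
Proof.
move=> /continuous_mxP cA; apply/continuous_mxP => i j.
by rewrite (_ : (fun x => _) = fun x => A x j i)//; apply/funext => x; rewrite mxE.
Qed.

Lemma continuous_det (R : realType) (T : topologicalType) n
    (A : T -> 'M[R]_n) : continuous A -> continuous (fun x => \det (A x)).
Proof.
move=> /continuous_mxP cA; apply: continuous_sum => s _ x.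
by apply: cvgM; [exact: cvg_cst|apply: continuous_prod => i _; exact: cA].
Qed.

Lemma continuous_invmx (R : realType) (T : topologicalType) n
    (A : T -> 'M[R]_n) : continuous A -> (forall x, A x \in unitmx) ->
  continuous (fun x => invmx (A x)).
Proof.
move=> cA uA.
have -> : (fun x => invmx (A x)) = (fun x => (\det (A x))^-1 *: \adj (A x)).
  by apply/funext => x; rewrite /invmx uA.
move=> x; apply: cvgZ.
  apply: cvgV; last exact: continuous_det.
  by have := uA x; rewrite unitmxE unitfE.
move: x; apply/continuous_mxP => i j.
rewrite (_ : (fun x => _) = fun x => cofactor (A x) j i); last first.
  by apply/funext => x; rewrite mxE.
move=> x; apply: cvgM; first exact: cvg_cst.
apply: (@continuous_det R T n.-1 (fun x => row' j (col' i (A x)))).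
apply/continuous_mxP => k l.
rewrite (_ : (fun x => _) = fun x => A x (lift j k) (lift i l)); last first.
  by apply/funext => y; rewrite !mxE.
exact: (continuous_mxP A).1.
Qed.

(** The quadratic form of [A] vanishes on the kernel of [A]. *)
Lemma posdef_unitmx (R : realType) d (A : 'M[R]_d) : posdef A -> A \in unitmx.
Proof.
move=> pA; rewrite -unitmx_tr -row_free_unit -kermx_eq0; apply/negPn/negP.
move=> /rowV0Pn[v /sub_kermxP vA v0].
have Av : A *m v^T = 0 by rewrite -[A]trmxK -trmx_mul vA trmx0.
have := pA v^T; rewrite -mulmxA Av mulmx0.
by rewrite mxE ltxx -trmx0 (inj_eq trmx_inj) v0 => /(_ isT).
Qed.

(** * Differentials, gradients and Jacobians *)

Lemma Ck_continuous (R : realType) (V W : normedModType R) k (f : V -> W) :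
  Ck k f -> continuous f.
Proof. by case: k => [//|k [df _]] x; exact: differentiable_continuous. Qed.

Lemma Ck_differentiable (R : realType) (V W : normedModType R) k (f : V -> W) :
  Ck k.+1 f -> forall x, differentiable f x.
Proof. by move=> [df _]. Qed.

Lemma Ck_diff (R : realType) (V W : normedModType R) k (f : V -> W) (v : V) :
  Ck k.+1 f -> Ck k (fun x => 'd f x v).
Proof. by move=> [_ Cf]; exact: Cf. Qed.

Lemma CkW (R : realType) (V W : normedModType R) k (f : V -> W) :
  Ck k.+1 f -> Ck k f.
Proof.
elim: k f => [|k IH] f Cf; first exact: Ck_continuous Cf.
by case: Cf => df Cf; split=> // v; apply: IH; exact: Cf.
Qed.

Lemma is_derive_comp_diff (R : realType) (V W : normedModType R) (f : V -> W)
    (p : R -> V) (p' : V) (x : R) :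
  differentiable f (p x) -> is_derive x 1 p p' ->
  is_derive x 1 (fun y => f (p y)) ('d f (p x) p').
Proof.
move=> df [dp <-]; have dp1 := (derivable1_diffP p x).1 dp.
apply: DeriveDef.
  by apply/derivable1_diffP; exact: (@differentiable_comp _ _ _ _ p f).
rewrite deriveE; last exact: (@differentiable_comp _ _ _ _ p f).
by rewrite (@diff_comp _ _ _ _ p f)//= deriveE.
Qed.

Lemma is_derive_pair (R : realType) (V W : normedModType R) (p : R -> V)
    (q : R -> W) (p' : V) (q' : W) (x : R) :
  is_derive x 1 p p' -> is_derive x 1 q q' ->
  is_derive x 1 (fun y => (p y, q y)) (p', q').
Proof.
move=> [dp <-] [dq <-]; have dp1 := (derivable1_diffP p x).1 dp.
have dq1 := (derivable1_diffP q x).1 dq.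
apply: DeriveDef.
  by apply/derivable1_diffP; exact: differentiable_pair.
rewrite deriveE; last exact: differentiable_pair.
by rewrite diff_pair// !deriveE.
Qed.

Lemma cV_sum_delta (R : realType) d (v : 'cV[R]_d) :
  v = \sum_i v i 0 *: delta_mx i 0.
Proof. by rewrite {1}[v]matrix_sum_delta; apply: eq_bigr => i _; rewrite big_ord1. Qed.

Lemma jac_mulmx (R : realType) d (S : 'cV[R]_d -> 'cV[R]_d) (p v : 'cV[R]_d) :
  differentiable S p -> jac S p *m v = 'd S p v.
Proof.
move=> dS; rewrite {2}[v]cV_sum_delta linear_sum/=.
apply/matrixP => i j; rewrite ord1 mxE summxE; apply: eq_bigr => k _.
by rewrite linearZ !mxE deriveE// mulrC.
Qed.

Lemma jac_continuous (R : realType) d (S : 'cV[R]_d -> 'cV[R]_d) :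
  Ck 1 S -> continuous (jac S).
Proof.
move=> [dS cS]; apply/continuous_mxP => i j.
rewrite (_ : (fun x => _) = fun p => ('d S p (delta_mx j 0)) i 0).
  exact: (continuous_mxP _).1 (cS (delta_mx j 0)) i 0.
by apply/funext => p; rewrite mxE deriveE.
Qed.

(** * The local energy *)

Lemma trmx_mul_sum (R : realType) d (a b : 'cV[R]_d) :
  (a^T *m b) 0 0 = \sum_i a i 0 * b i 0.
Proof. by rewrite mxE; apply: eq_bigr => i _; rewrite mxE. Qed.

Lemma pair_eq (A B : Type) (p q : A * B) : p.1 = q.1 -> p.2 = q.2 -> p = q.
Proof. by case: p q => [? ?] [? ?] /= -> ->. Qed.

Section energy.
Context {R : realType} {d : nat} (E : 'cV[R]_d -> 'cV[R]_d -> R).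
Let Ep (p : 'cV[R]_d * 'cV[R]_d) : R := E p.1 p.2.

Let derive_slice_l (v p q : 'cV[R]_d) :
  'D_v (fun w => E w q) p = 'D_((v, 0) : 'cV[R]_d * 'cV[R]_d) Ep (p, q).
Proof.
rewrite /derive [X in X @ _](_ : _ = (fun h : R => h^-1 *:
  ((Ep \o shift (p, q)) (h *: ((v, 0) : 'cV[R]_d * 'cV[R]_d)) - Ep (p, q))) :> (R -> R))//.
by apply/funext => h /=; rewrite /Ep/= scaler0 add0r.
Qed.

Let derive_slice_r (f : 'cV[R]_d * 'cV[R]_d -> R) (v p q : 'cV[R]_d) :
  'D_v (fun w => f (p, w)) q = 'D_((0, v) : 'cV[R]_d * 'cV[R]_d) f (p, q).
Proof.
rewrite /derive [X in X @ _](_ : _ = (fun h : R => h^-1 *: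
  ((f \o shift (p, q)) (h *: ((0, v) : 'cV[R]_d * 'cV[R]_d)) - f (p, q))) :> (R -> R))//.
apply/funext => h /=; congr (_ *: (f _ - _)).
by apply: pair_eq => /=; rewrite ?scaler0 ?add0r.
Qed.

(** The momentum [grad_v E], by components. *)
Let mom (i : 'I_d) (p : 'cV[R]_d * 'cV[R]_d) : R := 'd Ep p (0, delta_mx i 0).

Lemma grad_vE : (forall p, differentiable Ep p) ->
  forall p q i, grad_v E p q i 0 = 'd Ep (p, q) (0, delta_mx i 0).
Proof. by move=> dE p q i; rewrite mxE (derive_slice_r Ep) deriveE. Qed.

Lemma grad_uE : (forall p, differentiable Ep p) ->
  forall p q i, grad_u E p q i 0 = 'd Ep (p, q) (delta_mx i 0, 0).
Proof. by move=> dE p q i; rewrite mxE derive_slice_l deriveE. Qed.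

Let pair_sum_l (y : 'cV[R]_d) :
  (y, 0) = \sum_i y i 0 *: ((delta_mx i 0, 0) : 'cV[R]_d * 'cV[R]_d).
Proof.
rewrite {1}[y]cV_sum_delta; elim/big_rec2: _ => // i s t _ <-.
by apply: pair_eq => //=; rewrite scaler0 add0r.
Qed.

Let pair_sum_r (y : 'cV[R]_d) :
  (0, y) = \sum_i y i 0 *: ((0, delta_mx i 0) : 'cV[R]_d * 'cV[R]_d).
Proof.
rewrite {1}[y]cV_sum_delta; elim/big_rec2: _ => // i s t _ <-.
by apply: pair_eq => //=; rewrite scaler0 add0r.
Qed.

Let diff_l (f : 'cV[R]_d * 'cV[R]_d -> R) p (y : 'cV[R]_d) : differentiable f p ->
  'd f p (y, 0) = \sum_i y i 0 * 'd f p (delta_mx i 0, 0).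
Proof.
move=> df; rewrite pair_sum_l linear_sum/=; apply: eq_bigr => i _.
by rewrite linearZ.
Qed.

Let diff_r (f : 'cV[R]_d * 'cV[R]_d -> R) p (y : 'cV[R]_d) : differentiable f p ->
  'd f p (0, y) = \sum_i y i 0 * 'd f p (0, delta_mx i 0).
Proof.
move=> df; rewrite pair_sum_r linear_sum/=; apply: eq_bigr => i _.
by rewrite linearZ.
Qed.

Let diff_lr (f : 'cV[R]_d * 'cV[R]_d -> R) p (y z : 'cV[R]_d) : differentiable f p ->
  'd f p (y, z) = 'd f p (y, 0) + 'd f p (0, z).
Proof.
move=> df; rewrite -linearD; congr ('d f p _).
by apply: pair_eq => /=; rewrite ?addr0 ?add0r.
Qed.

Lemma grad_u_continuous : Ck 1 Ep -> continuous (fun p => grad_u E p.1 p.2).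
Proof.
move=> E_C1; apply/continuous_mxP => i j; rewrite ord1.
rewrite (_ : (fun w => _) = fun p => 'd Ep p (delta_mx i 0, 0)).
  exact: (Ck_continuous (Ck_diff _ E_C1)).
by apply/funext => -[p q]; rewrite grad_uE//; exact: Ck_differentiable E_C1.
Qed.

Section first_order.
Hypothesis E_C2 : Ck 2 Ep.
Hypothesis grad_v0 : forall p q, grad_v E p q = 0.
Let dE : forall p, differentiable Ep p := Ck_differentiable E_C2.

Lemma energy_velocity_free p q q' : E p q = E p q'.
Proof.
pose f (t : R) : R := Ep (p, q' + t *: (q - q')).
have df (t : R) : is_derive t 1 f ('d Ep (p, q' + t *: (q - q')) (0, q - q')).
  apply: (is_derive_comp_diff (p := fun t : R => (p, q' + t *: (q - q')))) => //.
  apply: is_derive_pair.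
  rewrite -[X in is_derive _ _ _ X]add0r.
  apply: (@is_deriveD _ _ _ (cst q') (fun t : R => t *: (q - q'))).
  apply: DeriveDef; first by apply/derivable1_diffP.
  by rewrite deriveE// diff_val scale1r.
have f0 t : 'd Ep (p, q' + t *: (q - q')) (0, q - q') = 0.
  rewrite diff_r// big1// => i _.
  by rewrite -grad_vE// grad_v0 [X in _ * X]mxE mulr0.
have := derive_eq0_const df f0 1 0.
by rewrite /f /Ep/= scale1r scale0r addr0 addrC subrK.
Qed.

Lemma grad_u_velocity_free p q q' : grad_u E p q = grad_u E p q'.
Proof.
congr (grad _ _); apply/funext => w; exact: energy_velocity_free.
Qed.

(** The velocity may be frozen at [u' x], which [E] does not see; in this way the
    derivative of [u'], which may fail to exist, does not occur. *)
Lemma energy1_derive (u u' : R -> 'cV[R]_d) (x : R) :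
  is_derive x 1 u (u' x) ->
  is_derive x 1 (fun y => E (u y) 0) (((grad_u E (u x) (u' x))^T *m u' x) 0 0).
Proof.
move=> du.
have -> : (fun y => E (u y) 0) = (fun y => Ep (u y, u' x)).
  by apply/funext => y; exact: energy_velocity_free.
have -> : ((grad_u E (u x) (u' x))^T *m u' x) 0 0 = 'd Ep (u x, u' x) (u' x, 0).
  rewrite trmx_mul_sum diff_l//; apply: eq_bigr => i _.
  by rewrite grad_uE// mulrC.
apply: (is_derive_comp_diff (p := fun y => (u y, u' x))) => //.
by apply: is_derive_pair; exact: is_derive_cst.
Qed.

End first_order.

Section second_order.
Hypothesis E_C3 : Ck 3 Ep.
Let dE : forall p, differentiable Ep p := Ck_differentiable E_C3.
Let mom_C2 i : Ck 2 (mom i). Proof. exact: Ck_diff. Qed.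
Let dmom i p : differentiable (mom i) p. Proof. exact: Ck_differentiable (mom_C2 i) p. Qed.

Lemma hess_vE p q i j : hess_v E p q i j = 'd (mom i) (p, q) (0, delta_mx j 0).
Proof.
have dg : derivable (fun w => grad (E p) w) q (delta_mx j 0).
  apply/derivable_mxP => k l; rewrite ord1.
  rewrite (_ : (fun w => _) = fun w => mom k (p, w)); last first.
    by apply/funext => w; exact: grad_vE.
  apply: diff_derivable.
  exact: (@differentiable_comp _ _ _ _ (fun w => (p, w)) (mom k)).
rewrite mxE derive_mx// mxE.
rewrite (_ : (fun w => _) = fun w => mom i (p, w)).
  by rewrite derive_slice_r deriveE.
by apply/funext => w; exact: grad_vE.
Qed.

Lemma hess_v_continuous : continuous (fun p => hess_v E p.1 p.2).
Proof.
apply/continuous_mxP => i j.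
rewrite (_ : (fun w => _) = fun p => 'd (mom i) p (0, delta_mx j 0)).
  exact: (Ck_continuous (Ck_diff _ (mom_C2 i))).
by apply/funext => -[p q]; rewrite hess_vE.
Qed.

(** The part of the time derivative of the momentum [grad_v E (u, u')] that does
    not involve [u'']. *)
Definition momentum_transport (p : 'cV[R]_d * 'cV[R]_d) : 'cV[R]_d :=
  \col_i \sum_j p.2 j 0 * 'd (mom i) p (delta_mx j 0, 0).

Lemma momentum_transport_continuous : continuous momentum_transport.
Proof.
apply/continuous_mxP => i j; rewrite ord1.
rewrite (_ : (fun w => _) = fun p : 'cV[R]_d * 'cV[R]_d =>
    \sum_k p.2 k 0 * 'd (mom i) p (delta_mx k 0, 0)); last first.
  by apply/funext => p; rewrite mxE.
apply: continuous_sum => k _ p; apply: cvgM.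
  apply: (@continuous_comp _ _ _ snd (fun v : 'cV[R]_d => v k 0)).
    exact: cvg_snd.
  exact: coord_continuous.
exact: (Ck_continuous (Ck_diff _ (mom_C2 i))).
Qed.

Lemma momentum_derive (u u' u'' : R -> 'cV[R]_d) (x : R) :
  is_derive x 1 u (u' x) -> is_derive x 1 u' (u'' x) ->
  is_derive x 1 (fun y => grad_v E (u y) (u' y))
    (hess_v E (u x) (u' x) *m u'' x + momentum_transport (u x, u' x)).
Proof.
move=> du du'.
have dm i : is_derive x 1 (fun y => mom i (u y, u' y))
    ('d (mom i) (u x, u' x) (u' x, u'' x)).
  apply: (is_derive_comp_diff (p := fun y => (u y, u' y))) => //.
  exact: is_derive_pair.
have gE i : (fun y => grad_v E (u y) (u' y) i 0) = fun y => mom i (u y, u' y).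
  by apply/funext => y; rewrite grad_vE.
have dg : derivable (fun y => grad_v E (u y) (u' y)) x 1.
  by apply/derivable_mxP => i j; rewrite ord1 gE; case: (dm i).
apply: DeriveDef => //; rewrite derive_mx//; apply/matrixP => i j.
rewrite ord1 mxE gE derive_val diff_lr// diff_l// diff_r// addrC.
rewrite !mxE; congr (_ + _); apply: eq_bigr => k _.
by rewrite hess_vE mulrC.
Qed.

(** The energy conserved by the Euler-Lagrange equation of the Lagrangian [E]. *)
Definition local_energy (p : 'cV[R]_d * 'cV[R]_d) : R :=
  E p.1 p.2 - \sum_i grad_v E p.1 p.2 i 0 * p.2 i 0.

Lemma local_energy_continuous : continuous local_energy.
Proof.
move=> p; apply: cvgB; first exact: (Ck_continuous E_C3).
move: p; apply: continuous_sum => i _ p; apply: cvgM.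
  rewrite (_ : (fun w => _) = mom i); last by apply/funext => -[? ?]; rewrite grad_vE.
  rewrite grad_vE//; have /= := Ck_continuous (mom_C2 i) (x := p).
  by case: p.
apply: (@continuous_comp _ _ _ snd (fun v : 'cV[R]_d => v i 0)).
  exact: cvg_snd.
exact: coord_continuous.
Qed.

Lemma energy2_derive (u u' u'' : R -> 'cV[R]_d) (x : R) :
  is_derive x 1 u (u' x) -> is_derive x 1 u' (u'' x) ->
  is_derive x 1 (fun y => local_energy (u y, u' y))
    (((grad_u E (u x) (u' x)
       - derive1 (fun y => grad_v E (u y) (u' y)) x)^T *m u' x) 0 0).
Proof.
move=> du du'; have dm := momentum_derive du du'.
have dE1 : is_derive x 1 (fun y => Ep (u y, u' y))
    ('d Ep (u x, u' x) (u' x, u'' x)).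
  apply: (is_derive_comp_diff (p := fun y => (u y, u' y))) => //.
  exact: is_derive_pair.
set m' := derive1 _ x.
have dmi i : is_derive x 1 (fun y => grad_v E (u y) (u' y) i 0) (m' i 0).
  apply: is_derive_entry; apply: DeriveDef; first by case: dm.
  by rewrite /m' derive1E.
have du'i i : is_derive x 1 (fun y => u' y i 0) (u'' x i 0).
  exact: is_derive_entry.
have -> : ((grad_u E (u x) (u' x) - m')^T *m u' x) 0 0 =
  'd Ep (u x, u' x) (u' x, u'' x) -
  \sum_i (grad_v E (u x) (u' x) i 0 *: u'' x i 0 + u' x i 0 *: m' i 0).
  rewrite trmx_mul_sum diff_lr// diff_l// diff_r// big_split/= -addrA.
  rewrite opprD addrA addrA.
  rewrite [X in _ = _ + X - _ - _](eq_bigr (fun i => grad_v E (u x) (u' x) i 0 *: u'' x i 0)).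
    rewrite addrK -sumrB; apply: eq_bigr => i _.
    by rewrite !mxE -grad_uE// mxE /GRing.scale/=; ring.
  by move=> i _; rewrite grad_vE// mulrC.
apply: (@is_deriveB _ _ _ (fun y => Ep (u y, u' y))
  (fun y => \sum_i grad_v E (u y) (u' y) i 0 * u' y i 0)).
rewrite (_ : (fun y => \sum_i _) =
  \sum_i ((fun y => grad_v E (u y) (u' y) i 0) * (fun y => u' y i 0))).
  apply: is_derive_sum => i; exact: is_deriveM.
by apply/funext => y; rewrite fct_sumE.
Qed.

End second_order.
End energy.

(** * Limit sets of curves whose derivatives vanish at an end *)

Section limit_sets.
Context {R : realType} {d : nat}.
Implicit Types (u g : R -> 'cV[R]_d) (F : set_system R).

(** With [F] one of the two ends of the line, this is [alpha_limit] or
    [omega_limit], by conversion. *)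
Definition end_limit F (k : nat) u : set (R -> 'cV[R]_d) :=
  [set g | Ck_curve k g /\
    exists tau : nat -> R, tau @ \oo --> F /\
      cvg_Ckloc k (fun n => phi (tau n) u) g].

Lemma derive1_phi (tau : R) u : (phi tau u)^`() = phi tau u^`().
Proof.
apply/funext => x; rewrite /derive1 /phi.
by under eq_fun do rewrite -addrA.
Qed.

Lemma derive1n_phi (tau : R) u j : (phi tau u)^`(j) = phi tau u^`(j).
Proof. by elim: j => [//|j IH]; rewrite !derive1nS IH derive1_phi. Qed.

Lemma derive1n_const (a : 'cV[R]_d) j : (0 < j)%N ->
  (fun _ : R => a)^`(j) = (fun _ => 0).
Proof.
case: j => // j _; elim: j => [|j IH].
  by apply/funext => x; exact: derive1_cst.
by rewrite derive1nS IH; apply/funext => x; exact: derive1_cst.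
Qed.

Lemma derive1n_const_is_const (a : 'cV[R]_d) j :
  exists b, (fun _ : R => a)^`(j) = (fun _ => b).
Proof. by case: j => [|j]; [exists a|exists 0; exact: derive1n_const]. Qed.

Lemma const_Ck_curve k (a : 'cV[R]_d) : Ck_curve k (fun=> a).
Proof.
split=> [j _ x|]; first by have [b ->] := derive1n_const_is_const a j.
by have [b ->] := derive1n_const_is_const a k; exact: cst_continuous.
Qed.

Lemma derive_zero_constant g (g' : R -> 'cV[R]_d) :
  (forall x : R, is_derive x 1 g (g' x)) -> (forall x, g' x = 0) ->
  constant_curve g.
Proof.
move=> dg g0; exists (g 0) => x; apply/matrixP => i j.
apply: (derive_eq0_const (f := fun y => g y i j) (f' := fun y => g' y i j)).
  by move=> t; exact: is_derive_entry.
by move=> t; rewrite g0 mxE.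
Qed.

Lemma curve_mean_value u (u' : R -> 'cV[R]_d) (e : R) (x t : R) :
  (forall y : R, is_derive y 1 u (u' y)) ->
  (forall s, `|s| <= `|t| -> `|u' (x + s)| <= e) ->
  `|u (x + t) - u x| <= e * `|t|.
Proof.
move=> du ue; have e0 : 0 <= e by apply: le_trans (ue 0 _); rewrite ?normr0.
apply: mx_norm_le; first by rewrite mulr_ge0.
move=> i j; rewrite !mxE.
have [z zx ->] := mean_value x (x + t) (fun y => is_derive_entry i j (du y)).
rewrite addrC addKr normrM ler_wpM2r// (le_trans (mx_norm_entry _ _ _))//.
have -> : z = x + (z - x) by ring.
apply: ue; have h1 := ler_norm t; have h2 := lerNnormlW (lexx `|t|).
by rewrite ler_norml; case: zx => /andP[z1 z2]; apply/andP; split; lra.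
Qed.

Lemma curve_lipschitz u (u' : R -> 'cV[R]_d) (M : R) :
  (forall y : R, is_derive y 1 u (u' y)) -> (forall y, `|u' y| <= M) ->
  forall x y, `|u x - u y| <= M * `|x - y|.
Proof.
move=> du uM x y; have := @curve_mean_value u u' M y (x - y) du (fun s _ => uM _).
by rewrite (_ : y + (x - y) = x)//; ring.
Qed.

Lemma compact_bound (A : set R) : compact A ->
  exists2 L, 0 <= L & forall x, A x -> `|x| <= L.
Proof.
move=> /compact_bounded[M [Mr MA]]; exists (`|M| + 1); first by rewrite addr_ge0.
by move=> x; apply: MA; rewrite (le_lt_trans (ler_norm M))// ltrDl.
Qed.

Lemma cvg_uniform_normP (f : nat -> R -> 'cV[R]_d) g (A : set R) :
  (forall e, 0 < e -> \forall n \near \oo, forall x, A x -> `|g x - f n x| < e) ->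
  {uniform A, f @ \oo --> g}.
Proof.
move=> fg P /uniform_nbhs[Q []].
rewrite -entourage_from_ballE => -[e /= e0 eQ] QP.
have := fg e e0; apply: filterS => n fe; apply: QP => x Ax; apply: eQ => /=.
by rewrite -ball_normE; exact: fe.
Qed.

Lemma cvg_Ckloc_pointwise k (f : nat -> R -> 'cV[R]_d) g j x :
  cvg_Ckloc k f g -> (j <= k)%N -> (f n)^`(j) x @[n --> \oo] --> g^`(j) x.
Proof.
move=> fg jk; have /fam_cvgP/(_ _ (@compact_set1 _ x)) := fg j jk.
by rewrite uniform_set1.
Qed.

Lemma end_cvg0_uniform F (f : R -> 'cV[R]_d) (tau : nat -> R) (L e : R) :
  ProperFilter F -> end_filter F -> tau n @[n --> \oo] --> F ->
  f x @[x --> F] --> (0 : 'cV[R]_d) -> 0 < e ->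
  \forall n \near \oo, forall t, `|t| <= L -> `|f (tau n + t)| < e.
Proof.
move=> FF [wF _] tauF /cvgrPdist_lt f0 e0; have h : \forall n \near \oo, forall t, `|t| <= L ->
    `|0 - f (tau n + t)| < e := tauF _ (wF _ L (f0 e e0)).
by apply: filterS h => n h t /h; rewrite sub0r normrN.
Qed.

(** By boundedness [u (tau n)] tends to some [a] along a sequence going to the end;
    since [u'] vanishes there, [u] stays close to [a] on windows of fixed length. *)
Lemma end_limit_nonempty F k u (M : R) :
  ProperFilter F -> end_filter F -> (0 < k)%N ->
  (forall x, `|u x| <= M) -> (forall x : R, is_derive x 1 u (u^`() x)) ->
  (forall j, (0 < j <= k)%N -> u^`(j) x @[x --> F] --> (0 : 'cV[R]_d)) ->
  end_limit F k u !=set0.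
Proof.
move=> FF eF k0 uM du uj.
have [tau [a [tauF ua]]] := end_cluster_sequence FF eF uM.
have uniform_small (j : nat) (L e : R) (jk : (0 < j <= k)%N) (e0 : 0 < e) :=
  @end_cvg0_uniform F _ tau L e FF eF tauF (uj j jk) e0.
exists (fun=> a); split; first exact: const_Ck_curve.
exists tau; split => // j jk; apply/fam_cvgP => A /compact_bound[L L0 AL].
apply: cvg_uniform_normP => e e0.
case: j jk => [_|j jk]; last first.
  have := uniform_small j.+1 L e jk e0; apply: filterS => n h x Ax.
  by rewrite derive1n_phi derive1n_const// sub0r normrN /phi [x + _]addrC; exact/h/AL.
have e2 : 0 < e / 2 by rewrite divr_gt0.
have eL : 0 < e / 2 / (L + 1) by rewrite divr_gt0// ltr_wpDl.
move/cvgrPdist_lt : ua => /(_ _ e2) ua; near=> n => x Ax.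
have h1 : `|a - u (tau n)| < e / 2 by near: n.
have h2 : `|u (tau n + x) - u (tau n)| <= e / 2 / (L + 1) * `|x|.
  apply: (curve_mean_value du) => s sx; apply: ltW.
  have sL := le_trans sx (AL _ Ax).
  move: s sL {sx}; near: n; exact: (uniform_small 1%N L _ k0 eL).
have h3 : e / 2 / (L + 1) * `|x| < e / 2.
  rewrite -mulrA gtr_pMr// mulrC ltr_pdivrMr ?ltr_wpDl// mul1r.
  by have := AL _ Ax; lra.
rewrite !derive1n0 /phi [x + tau n]addrC.
have -> : a - u (tau n + x) = (a - u (tau n)) - (u (tau n + x) - u (tau n)).
  by rewrite opprB addrA subrK.
have := ler_normB (a - u (tau n)) (u (tau n + x) - u (tau n)); lra.
Unshelve. all: by end_near. Qed.

Lemma end_limit_constant F k u :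
  ProperFilter F -> end_filter F -> (0 < k)%N ->
  u^`() x @[x --> F] --> (0 : 'cV[R]_d) ->
  end_limit F k u `<=` constant_curve.
Proof.
move=> FF eF k0 u'0 g [[dg _] [tau [tauF ug]]].
apply: (@derive_zero_constant g g^`()) => x.
  by apply: DeriveDef; [exact: (dg 0%N k0)|rewrite derive1E].
have h1 := @cvg_Ckloc_pointwise k _ g 1%N x ug k0.
have h2 : (phi (tau n) u)^`(1) x @[n --> \oo] --> (0 : 'cV[R]_d).
  rewrite (_ : (fun n => _) = (fun n => u^`() (tau n + x))); last first.
    by apply/funext => n; rewrite derive1n_phi /phi addrC.
  apply/cvgrPdist_lt => e e0.
  apply: filterS (@end_cvg0_uniform F _ tau `|x| e FF eF tauF u'0 e0) => n.
  by move=> /(_ x (lexx _)); rewrite sub0r normrN.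
exact: (@cvg_unique _ (@norm_hausdorff R 'cV[R]_d) _ _ _ _ h1 h2).
Qed.

End limit_sets.

(** * Matrix kernels *)

Lemma measurable_bigmaxr (R : realType) (disp : measure_display)
    (T : measurableType disp) (I : Type) (s : seq I) (f : I -> T -> R) :
  (forall i, measurable_fun setT (f i)) ->
  measurable_fun setT (fun x => \big[Num.max/0]_(i <- s) f i x).
Proof.
move=> mf; elim: s => [|i s IH].
  by under eq_fun do rewrite big_nil; exact: measurable_cst.
by under eq_fun do rewrite big_cons; exact: measurable_maxr.
Qed.

Lemma finite_moment_entry (R : realType) d (K : R -> 'M[R]_d) :
  (forall i j, lebesgue_measure.-integrable setT (fun r => (K r i j)%:E)) ->
  (\int[lebesgue_measure]_r ((1 + `|r|) * `|K r|)%:E < +oo)%E ->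
  forall i j, finite_moment (fun r => K r i j).
Proof.
move=> Ki Km i j.
have mK k l : measurable_fun setT (fun r => K r k l).
  by have /integrableP[/measurable_EFinP] := Ki k l.
have mn : measurable_fun setT (fun r : R => 1 + `|r|).
  by apply: measurable_funD => //; exact: measurableT_comp.
have mabs k l : measurable_fun setT (fun r => `|K r k l|).
  exact: measurableT_comp.
split => //.
apply: (@le_integrable _ _ _ (@lebesgue_measure R) _ _ _ (fun r => ((1 + `|r|) * `|K r|)%:E)) => //.
- by apply/measurable_EFinP; exact: measurable_funM (mabs i j).
- move=> r _; rewrite !abse_EFin lee_fin !normrM !normr_id ler_wpM2l//.
  exact: mx_norm_entry.
apply/integrableP; split.
  apply/measurable_EFinP; apply: measurable_funM => //.
  rewrite (_ : (fun r => `|K r|) =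
      fun r => \big[Num.max/0]_(ij : 'I_d * 'I_d) `|K r ij.1 ij.2|).
    by apply: measurable_bigmaxr => ij; exact: mabs.
  by apply/funext => r; rewrite [LHS]/Num.Def.normr/= mx_normrE.
apply: le_lt_trans Km; rewrite le_eqVlt; apply/predU1P; left.
apply: eq_integral => r _.
by rewrite abse_EFin ger0_norm// mulr_ge0// addr_ge0.
Qed.

Lemma Rintegral_sum (R : realType) (I : Type) (s : seq I) (f : I -> R -> R) :
  (forall i, lebesgue_measure.-integrable setT (fun r => (f i r)%:E)) ->
  lebesgue_measure.-integrable setT (fun r => (\sum_(i <- s) f i r)%:E) /\
  (\int[lebesgue_measure]_r (\sum_(i <- s) f i r) =
   \sum_(i <- s) \int[lebesgue_measure]_r f i r)%R.
Proof.
move=> fi; elim: s => [|i s [IH1 IH2]].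
  split; first by under eq_fun do rewrite big_nil; exact: integrable0.
  rewrite big_nil; under eq_Rintegral do rewrite big_nil.
  by rewrite /Rintegral integral0.
split.
  under eq_fun do rewrite big_cons EFinD.
  exact: integrableD.
under eq_Rintegral do rewrite big_cons.
rewrite big_cons -IH2 -RintegralD; [exact: eq_Rintegral|exact: measurableT|exact: fi|exact: IH1].
Qed.

Section kconv.
Context {R : realType} {d : nat} (K : R -> 'M[R]_d) (w : R -> 'cV[R]_d) (C L : R).
Context (mK : forall i j, finite_moment (fun r => K r i j)).
Context (cw : continuous w) (wC : forall x, `|w x| <= C).
Context (wL : forall x y, `|w x - w y| <= L * `|x - y|).

Let cwj j : continuous (fun x => w x j 0).
Proof. exact: (continuous_mxP w).1. Qed.
Let wjC j x : `|w x j 0| <= C.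
Proof. exact: le_trans (mx_norm_entry _ _ _) (wC x). Qed.
Let wjL j x y : `|w x j 0 - w y j 0| <= L * `|x - y|.
Proof.
by apply: le_trans (wL x y); have := mx_norm_entry (w x - w y) j 0; rewrite !mxE.
Qed.
Let mwj j : measurable_fun setT (fun x => w x j 0).
Proof. exact: continuous_measurable_fun. Qed.
Let C_ge0 : 0 <= C. Proof. exact: le_trans (wC 0). Qed.

Lemma kconv_entry x i :
  kconv K w x i 0 = \sum_j conv (fun r => K r i j) (fun y => w y j 0) x.
Proof.
rewrite mxE.
have ij j : lebesgue_measure.-integrable setT
    (fun y => (K (x - y) i j * w y j 0)%:E).
  have h : lebesgue_measure.-integrable setT
      (fun r => (K r i j * w (x - r) j 0)%:E).
    apply: (integrable_moment (mK i j) (C := C)).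
      exact: (measurable_comp_reflect x (mwj j)).
    by move=> r; rewrite (le_trans (wjC _ _))// ler_peMr// lerDl.
  have := integrable_reflect x h.
  by under eq_fun do rewrite subKr.
have [_ <-] := Rintegral_sum (index_enum _) ij.
by apply: eq_Rintegral => y _; rewrite mxE.
Qed.

Lemma kconv_lipschitz : exists B, forall x y,
  `|kconv K w x - kconv K w y| <= B * `|x - y|.
Proof.
have L0 (x y : R) : 0 <= L * `|x - y| by exact: le_trans (normr_ge0 _) (wL x y).
exists (\sum_i \sum_j L * moment (fun r => K r i j)) => x y.
have m0 i j : 0 <= L * moment (fun r => K r i j) * `|x - y|.
  by rewrite mulrAC mulr_ge0// moment_ge0.
apply: mx_norm_le.
  by rewrite mulr_suml sumr_ge0// => i _; rewrite mulr_suml sumr_ge0.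
move=> i j; rewrite ord1 mxE [X in _ + X]mxE !kconv_entry -sumrB.
rewrite (le_trans (ler_norm_sum _ _ _))// mulr_suml [in leRHS](bigD1 i)//=.
rewrite -[X in X <= _]addr0 lerD//; last first.
  by apply: sumr_ge0 => k _; rewrite mulr_suml sumr_ge0.
rewrite mulr_suml; apply: ler_sum => k _.
exact: (conv_lipschitz (mK i k) (C := C)).
Qed.

Lemma kconv_bounded : exists B, forall x, `|kconv K w x| <= B.
Proof.
exists (\sum_i \sum_j C * moment (fun r => K r i j)) => x.
have m0 i j : 0 <= C * moment (fun r => K r i j) by rewrite mulr_ge0// moment_ge0.
apply: mx_norm_le; first by rewrite sumr_ge0// => i _; rewrite sumr_ge0.
move=> i j; rewrite ord1 kconv_entry.
rewrite (le_trans (ler_norm_sum _ _ _))// [in leRHS](bigD1 i)//=.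
rewrite -[X in X <= _]addr0 lerD//; last first.
  by apply: sumr_ge0 => k _; rewrite sumr_ge0.
by apply: ler_sum => k _; exact: (conv_bounded (mK i k)).
Qed.

End kconv.

Lemma norm_mulmx_le (R : realType) d (A : 'M[R]_d) (v : 'cV[R]_d) :
  `|A *m v| <= d%:R * `|A| * `|v|.
Proof.
apply: mx_norm_le; first by rewrite !mulr_ge0.
move=> i j; rewrite mxE (le_trans (ler_norm_sum _ _ _))//.
apply: (@le_trans _ _ (\sum_(k < d) `|A| * `|v|)).
  by apply: ler_sum => k _; rewrite normrM ler_pM// mx_norm_entry.
by rewrite sumr_const card_ord -mulrA mulr_natl.
Qed.

(** * Regularity and energy of solutions *)

Lemma eq_orderP (R : realType) d (E : 'cV[R]_d -> 'cV[R]_d -> R) :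
  ((forall w v, grad_v E w v = 0) \/ (forall w v, hess_v E w v \in unitmx)) ->
  (eq_order E = 1%N /\ forall w v, grad_v E w v = 0) \/
  (eq_order E = 2%N /\ forall w v, hess_v E w v \in unitmx).
Proof.
move=> nd; rewrite /eq_order; case: asboolP => [g0|ng0]; first by left.
by right; case: nd.
Qed.

Lemma curve_is_derive (R : realType) d k (u : R -> 'cV[R]_d) j :
  Ck_curve k u -> (j < k)%N -> forall x : R, is_derive x 1 u^`(j) (u^`(j.+1) x).
Proof.
move=> [du _] jk x; apply: DeriveDef; first exact: du.
by rewrite derive1nS derive1E.
Qed.

Lemma curve_continuous (R : realType) d k (u : R -> 'cV[R]_d) j :
  Ck_curve k u -> (j <= k)%N -> continuous u^`(j).
Proof.
move=> Cu; rewrite leq_eqVlt => /predU1P[->|jk]; first by case: Cu.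
by move=> x; exact: is_derive_continuous (curve_is_derive Cu jk x).
Qed.

(** In the first-order case [E] does not depend on the velocity, and [E (u, 0)] can
    be differentiated with only one derivative of [u] at hand. *)
Lemma exists_energy (R : realType) d (E : 'cV[R]_d -> 'cV[R]_d -> R)
    (u : R -> 'cV[R]_d) :
  ((forall w v, grad_v E w v = 0) \/ (forall w v, hess_v E w v \in unitmx)) ->
  Ck (eq_order E).+1 (fun p : 'cV[R]_d * 'cV[R]_d => E p.1 p.2) ->
  Ck_curve (eq_order E) u ->
  exists h : 'cV[R]_d * 'cV[R]_d -> R, continuous h /\
    forall x : R, is_derive x 1 (fun y => h (u y, derive1 u y))
      (((grad_u E (u x) (derive1 u x) -
         derive1 (fun y => grad_v E (u y) (derive1 u y)) x)^T *m derive1 u x) 0 0).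
Proof.
move=> /eq_orderP[[-> g0]|[-> _]] EC uC.
  exists (fun p => E p.1 0); split.
    move=> p; apply: (@continuous_comp _ _ _ (fun p : 'cV[R]_d * 'cV[R]_d => (p.1, 0 : 'cV[R]_d))
      (fun p : 'cV[R]_d * 'cV[R]_d => E p.1 p.2)).
      by apply: (@cvg_pair _ _ _ _ (nbhs p.1) (nbhs (0 : 'cV[R]_d))); [exact: cvg_fst|exact: cvg_cst].
    exact: (Ck_continuous EC).
  move=> x; rewrite (_ : (fun y => grad_v E _ _) = fun=> 0); last first.
    by apply/funext => y; rewrite g0.
  rewrite [X in _ - X]derive1_cst subr0.
  exact: (energy1_derive EC g0 (curve_is_derive uC (ltn0Sn 0) x)).
exists (local_energy E); split; first exact: local_energy_continuous.
move=> x; apply: (energy2_derive EC (u'' := derive1n 2 u)).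
  exact: (curve_is_derive uC (isT : 0 < 2)%N x).
exact: (curve_is_derive uC (isT : 1 < 2)%N x).
Qed.

(** The equation can be solved for the derivative of highest order, which makes it
    a continuous function of lower order terms; these are uniformly continuous. *)
Lemma top_derivative_unif_continuous (R : realType) d
    (E : 'cV[R]_d -> 'cV[R]_d -> R) (Gamma J : 'cV[R]_d -> 'M[R]_d) (c M : R)
    (u kap : R -> 'cV[R]_d) :
  ((forall w v, grad_v E w v = 0) \/ (forall w v, hess_v E w v \in unitmx)) ->
  Ck (eq_order E).+1 (fun p : 'cV[R]_d * 'cV[R]_d => E p.1 p.2) ->
  Ck_curve (eq_order E) u -> c != 0 -> continuous Gamma ->
  (forall w, Gamma w \in unitmx) -> continuous J ->
  unif_continuous kap -> (forall x, `|kap x| <= M) ->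
  (forall j, (j <= eq_order E)%N -> forall x, `|derive1n j u x| <= M) ->
  (forall x, - derive1 (fun y => grad_v E (u y) (derive1 u y)) x
     + grad_u E (u x) (derive1 u x) + (J (u x))^T *m kap x
     = c *: (Gamma (u x) *m derive1 u x)) ->
  unif_continuous (derive1n (eq_order E) u).
Proof.
move=> /eq_orderP[[-> g0]|[-> Hu]] EC uC c0 cG Gu cJ ukap kapM uM eqn.
- have du x := curve_is_derive uC (isT : 0 < 1)%N x.
  have uu : unif_continuous u.
    by apply: lipschitz_unif_continuous; exact: curve_lipschitz du (uM 1%N isT).
  pose Phi (p : 'cV[R]_d * 'cV[R]_d) : 'cV[R]_d :=
    c^-1 *: (invmx (Gamma p.1) *m (grad_u E p.1 0 + (J p.1)^T *m p.2)).
  have -> : derive1n 1 u = Phi \o (fun x => (u x, kap x)).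
    apply/funext => x; rewrite /Phi/= -(grad_u_velocity_free EC g0 _ (derive1 u x)).
    have := eqn x; rewrite (_ : (fun y => grad_v E _ _) = fun=> 0); last first.
      by apply/funext => y; rewrite g0.
    rewrite [X in - X]derive1_cst oppr0 add0r => ->.
    by rewrite -scalemxAr scalerA mulVf// scale1r mulKmx.
  apply: (unif_continuous_comp_compact (@compact_cV_ball2 R d M)).
  + have c1 : continuous (fun p : 'cV[R]_d * 'cV[R]_d => p.1) by move=> p; exact: cvg_fst.
    have c2 : continuous (fun p : 'cV[R]_d * 'cV[R]_d => p.2) by move=> p; exact: cvg_snd.
    move=> p; apply: cvgZ; first exact: cvg_cst.
    move: p; apply: continuous_mulmx.
      apply: continuous_invmx; last by move=> p; exact: Gu.
      move=> p; exact: (@continuous_comp _ _ _ fst Gamma p (c1 p) (cG _)).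
    move=> p; apply: cvgD.
      apply: (@continuous_comp _ _ _ (fun p : 'cV[R]_d * 'cV[R]_d => (p.1, 0 : 'cV[R]_d))
        (fun p => grad_u E p.1 p.2)).
        by apply: (@cvg_pair _ _ _ _ (nbhs p.1) (nbhs (0 : 'cV[R]_d)));
          [exact: cvg_fst|exact: cvg_cst].
      exact: grad_u_continuous (CkW EC) _.
    move: p; apply: continuous_mulmx => //; apply: continuous_trmx => p.
    exact: (@continuous_comp _ _ _ fst J p (c1 p) (cJ _)).
  + by move=> x; split => /=; [exact: (uM 0%N)|exact: kapM].
  + exact: unif_continuous_pair.
- have du x := curve_is_derive uC (isT : 0 < 2)%N x.
  have du1 x := curve_is_derive uC (isT : 1 < 2)%N x.
  have uu : unif_continuous u.
    by apply: lipschitz_unif_continuous; exact: curve_lipschitz du (uM 1%N isT).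
  have uu1 : unif_continuous (derive1 u).
    by apply: lipschitz_unif_continuous; exact: curve_lipschitz du1 (uM 2%N isT).
  pose Phi (p : ('cV[R]_d * 'cV[R]_d) * 'cV[R]_d) : 'cV[R]_d :=
    invmx (hess_v E p.1.1 p.1.2) *m
      (grad_u E p.1.1 p.1.2 + (J p.1.1)^T *m p.2
       - c *: (Gamma p.1.1 *m p.1.2) - momentum_transport E p.1).
  have -> : derive1n 2 u = Phi \o (fun x => ((u x, derive1 u x), kap x)).
    apply/funext => x; rewrite /Phi/= -(eqn x).
    have dm : is_derive x 1 (fun y => grad_v E (u y) (derive1 u y))
      (hess_v E (u x) (derive1 u x) *m derive1n 2 u x
       + momentum_transport E (u x, derive1 u x)).
      exact: (momentum_derive EC (du x) (du1 x)).
    have -> : derive1 (fun y => grad_v E (u y) (derive1 u y)) x =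
        hess_v E (u x) (derive1 u x) *m derive1n 2 u x
        + momentum_transport E (u x, derive1 u x).
      by rewrite [LHS]derive1E; case: dm => _ ->.
    rewrite -[LHS](mulKmx (Hu (u x) (derive1 u x))); congr (_ *m _).
    set H := hess_v E _ _ *m _; set T := momentum_transport _ _.
    set g := grad_u E _ _; set k := _ *m kap x.
    by rewrite -(addrA (- (H + T))) opprD opprK addrCA subrr addr0 addrK.
  have cA := compact_setX (@compact_cV_ball2 R d M) (@compact_cV_ball R d M).
  apply: (unif_continuous_comp_compact cA).
  + have c0' : continuous (fun p : 'cV[R]_d * 'cV[R]_d * 'cV[R]_d => p.1).
      by move=> p; exact: cvg_fst.
    have c1 : continuous (fun p : 'cV[R]_d * 'cV[R]_d * 'cV[R]_d => p.1.1).
      by move=> p; exact: (@continuous_comp _ _ _ fst fst p (c0' p) cvg_fst).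
    have c2 : continuous (fun p : 'cV[R]_d * 'cV[R]_d * 'cV[R]_d => p.1.2).
      by move=> p; exact: (@continuous_comp _ _ _ fst snd p (c0' p) cvg_snd).
    have c3 : continuous (fun p : 'cV[R]_d * 'cV[R]_d * 'cV[R]_d => p.2).
      by move=> p; exact: cvg_snd.
    apply: continuous_mulmx.
      apply: continuous_invmx; last by move=> p; exact: Hu.
      move=> p; exact: (@continuous_comp _ _ _ fst
        (fun p : 'cV[R]_d * 'cV[R]_d => hess_v E p.1 p.2) p (c0' p)
        (@hess_v_continuous _ _ _ EC _)).
    move=> p; apply: cvgB; last first.
      exact: (@continuous_comp _ _ _ fst (momentum_transport E) p (c0' p)
        (@momentum_transport_continuous _ _ _ EC _)).
    apply: cvgB; last first.
      apply: cvgZ; first exact: cvg_cst.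
      move: p; apply: continuous_mulmx => // p.
      exact: (@continuous_comp _ _ _ (fst \o fst) Gamma p (c1 p) (cG _)).
    apply: cvgD.
      exact: (@continuous_comp _ _ _ fst
        (fun p : 'cV[R]_d * 'cV[R]_d => grad_u E p.1 p.2) p (c0' p)
        (@grad_u_continuous _ _ _ (CkW (CkW EC)) _)).
    move: p; apply: continuous_mulmx => //; apply: continuous_trmx => p.
    exact: (@continuous_comp _ _ _ (fst \o fst) J p (c1 p) (cJ _)).
  + move=> x; split => /=; last exact: kapM.
    by split; [exact: (uM 0%N)|exact: (uM 1%N)].
  + by apply: unif_continuous_pair => //; exact: unif_continuous_pair.
Qed.

(** * The Lyapunov function *)

Lemma is_derive_sum_fun (R : realType) n (h h' : 'I_n -> R -> R) (x : R) :
  (forall i, is_derive x 1 (h i) (h' i x)) ->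
  is_derive x 1 (fun y => \sum_i h i y) (\sum_i h' i x).
Proof.
move=> dh; rewrite (_ : (fun y => _) = \sum_i h i).
  exact: is_derive_sum.
by apply/funext => y; rewrite fct_sumE.
Qed.

Lemma cvg_sum_ord (R : realType) (T : Type) (F : set_system T) n
    (f : 'I_n -> T -> R) (l : 'I_n -> R) : Filter F ->
  (forall i, f i x @[x --> F] --> l i) ->
  \sum_i f i x @[x --> F] --> \sum_i l i.
Proof. by move=> FF fl; apply: cvg_big => //; exact: add_continuous. Qed.

Lemma bounded_sum (R : realType) n (h : 'I_n -> R -> R) :
  (forall i, exists B, forall x, `|h i x| <= B) ->
  exists B, forall x, `|\sum_i h i x| <= B.
Proof.
move=> /choice[B hB]; exists (\sum_i B i) => x.
by rewrite (le_trans (ler_norm_sum _ _ _))// ler_sum.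
Qed.

Lemma homo_bounded_cvg (R : realType) (V : R -> R) (B : R) :
  {homo V : x y / x <= y} -> (forall x, `|V x| <= B) ->
  (exists l : R, V x @[x --> +oo] --> l) /\ (exists l : R, V x @[x --> -oo] --> l).
Proof.
move=> hV VB; split.
  exists (sup (range V)); apply: nondecreasing_cvgr => //.
  by exists B => _ [x _ <-]; exact: le_trans (ler_norm _) (VB x).
exists (- sup (range (fun x => - V (- x)))); apply/cvgNy_compNP.
rewrite (_ : V \o _ = - (fun x => - V (- x))).
  apply: cvgN; apply: nondecreasing_cvgr => [x y xy|].
    by rewrite lerN2 hV// lerN2.
  exists B => _ [x _ <-]; apply: le_trans (ler_norm _) _.
  by rewrite normrN; exact: VB.
by apply/funext => x; rewrite /= opprK.
Qed.

Section solution.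
Context {R : realType} {d : nat}.
Context (K : R -> 'M[R]_d) (S : 'cV[R]_d -> 'cV[R]_d).
Context (E : 'cV[R]_d -> 'cV[R]_d -> R) (Gamma : 'cV[R]_d -> 'M[R]_d).
Context (c : R) (u : R -> 'cV[R]_d).
Context (K_even : forall r, K r = K (- r)) (K_sym : forall r, K r = (K r)^T).
Context (mK : forall i j, finite_moment (fun r => K r i j)).
Context (S_C1 : Ck 1 S).
Context (Gamma_continuous : continuous Gamma).
Context (Gamma_posdef : forall w, posdef (Gamma w)).
Context (c_neq0 : c != 0).
Context (E_smooth :
  Ck (eq_order E).+1 (fun p : 'cV[R]_d * 'cV[R]_d => E p.1 p.2)).
Context (E_nondegenerate :
  (forall w v, grad_v E w v = 0) \/ (forall w v, hess_v E w v \in unitmx)).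
Context (u_CRb : Ckb_curve (eq_order E) u).
Context (u_solution : forall x,
     - derive1 (fun y => grad_v E (u y) (derive1 u y)) x
       + grad_u E (u x) (derive1 u x)
       + (jac S (u x))^T *m kconv K (S \o u) x
     = c *: (Gamma (u x) *m derive1 u x)).

Local Notation kap := (kconv K (S \o u)).
Local Notation u' := (derive1 u).

Let order_gt0 : (0 < eq_order E)%N.
Proof. by have [[-> _]|[-> _]] := eq_orderP E_nondegenerate. Qed.

Let du (x : R) : is_derive x 1 u (u' x).
Proof. exact: (curve_is_derive (proj1 u_CRb) order_gt0 x). Qed.

Let cu' : continuous u'.
Proof. exact: (@curve_continuous _ _ _ u 1 (proj1 u_CRb) order_gt0). Qed.

Let u_bound : {M : R | forall j, (j <= eq_order E)%N ->
  forall x, `|derive1n j u x| <= M}.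
Proof.
apply: cid; have [_ uM] := u_CRb.
have /choice[B uB] : forall j : 'I_(eq_order E).+1, exists M,
    forall x, `|derive1n j u x| <= M.
  by move=> j; apply: uM; rewrite -ltnS.
exists (\sum_j `|B j|) => j jk x.
have jk' : (j < (eq_order E).+1)%N by rewrite ltnS.
rewrite (bigD1 (Ordinal jk'))//= (le_trans (uB (Ordinal jk') x))//.
by rewrite (le_trans (ler_norm _))// lerDl sumr_ge0.
Qed.

Let M := sval u_bound.
Let uM x : `|u x| <= M. Proof. exact: (svalP u_bound 0%N). Qed.
Let u'M x : `|u' x| <= M. Proof. exact: (svalP u_bound 1%N). Qed.

Let uu' x : [set p : 'cV[R]_d * 'cV[R]_d | `|p.1| <= M /\ `|p.2| <= M] (u x, u' x).
Proof. by split; [exact: uM|exact: u'M]. Qed.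

Let w x := S (u x).
Let w' x := jac S (u x) *m u' x.

Let dw (x : R) : is_derive x 1 w (w' x).
Proof.
have dS := Ck_differentiable S_C1.
rewrite /w' jac_mulmx//; exact: is_derive_comp_diff.
Qed.

Let cw' : continuous w'.
Proof.
apply: continuous_mulmx => // x.
apply: (@continuous_comp _ _ _ u (jac S)).
  exact: is_derive_continuous.
exact: jac_continuous.
Qed.

Let jac_bound : exists B, forall x, `|jac S (u x)| <= B.
Proof.
exact: (bounded_comp_compact (@compact_cV_ball R d M) (jac_continuous S_C1) uM).
Qed.

Let w_bound : {C : R | forall x, `|w x| <= C /\ `|w' x| <= C}.
Proof.
apply: cid.
have [B SB] := bounded_comp_compact (@compact_cV_ball R d M) (Ck_continuous S_C1) uM.
have [B' JB] := jac_bound.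
exists (Num.max B (d%:R * B' * M)) => x; split; rewrite le_max; first by rewrite SB.
apply/orP; right; rewrite (le_trans (norm_mulmx_le _ _))//.
by rewrite ler_pM ?mulr_ge0// ler_wpM2l.
Qed.

Let C := sval w_bound.
Let wC x : `|w x| <= C. Proof. by case: (svalP w_bound x). Qed.
Let w'C x : `|w' x| <= C. Proof. by case: (svalP w_bound x). Qed.

Let w_lip x y : `|w x - w y| <= C * `|x - y|.
Proof. exact: curve_lipschitz dw w'C x y. Qed.

Let cw : continuous w. Proof. by move=> x; exact: is_derive_continuous (dw x). Qed.

Let dwi i (x : R) : is_derive x 1 (fun y => w y i 0) (w' x i 0).
Proof. exact: is_derive_entry. Qed.
Let cw'i i : continuous (fun x => w' x i 0).
Proof. exact: (continuous_mxP w').1. Qed.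
Let wiC i x : `|w x i 0| <= C.
Proof. exact: le_trans (mx_norm_entry _ _ _) (wC x). Qed.
Let w'iC i x : `|w' x i 0| <= C.
Proof. exact: le_trans (mx_norm_entry _ _ _) (w'C x). Qed.

Let Kij_even i j r : K r i j = K (- r) i j. Proof. by rewrite K_even. Qed.

Let energy : {h : 'cV[R]_d * 'cV[R]_d -> R | continuous h /\
    forall x : R, is_derive x 1 (fun y => h (u y, u' y))
      (((grad_u E (u x) (u' x) -
         derive1 (fun y => grad_v E (u y) (u' y)) x)^T *m u' x) 0 0)}.
Proof.
by apply: cid; exact: exists_energy E_nondegenerate E_smooth (proj1 u_CRb).
Qed.

Let h := sval energy.

Let N i j : R -> R :=
  nonlocal_energy (fun r => K r i j) (fun x => w x j 0) (dwi i) (@cw'i j).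

Let cv i j l x := conv (fun r : R => K r i j) (fun y : R => w y l 0) x.

Let dN i j (x : R) : is_derive x 1 (N i j)
  (w' x i 0 * cv i j j x +
   w' x j 0 * cv i j i x).
Proof.
exact: (nonlocal_energy_derive (C := C) (mK i j) (Kij_even i j) (dwi i) (dwi j) (@cw'i j)).
Qed.

(** The sum of the local and the nonlocal energy; dividing by [c] makes it
    nondecreasing whatever the sign of [c]. *)
Definition lyapunov (x : R) : R :=
  c^-1 * (h (u x, u' x) + 2^-1 * \sum_i \sum_j N i j x).

Definition dissipation (p : 'cV[R]_d * 'cV[R]_d) : R :=
  (p.2^T *m Gamma p.1 *m p.2) 0 0.

(** Both halves of the symmetrised sum are equal because [K] is symmetric. *)
Let w'_kap x :
  2^-1 * \sum_i \sum_j
    (w' x i 0 * cv i j j x +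
     w' x j 0 * cv i j i x)
  = ((w' x)^T *m kap x) 0 0.
Proof.
have -> : ((w' x)^T *m kap x) 0 0 = \sum_i \sum_j
    w' x i 0 * cv i j j x.
  rewrite trmx_mul_sum; apply: eq_bigr => i _.
  by rewrite (kconv_entry mK cw wC) mulr_sumr.
under eq_bigr do rewrite big_split/=.
rewrite big_split/= [X in _ + X]exchange_big/=.
rewrite [X in _ + X](_ : _ = \sum_i \sum_j
    w' x i 0 * cv i j j x).
  by set X := \sum_i _; lra.
apply: eq_bigr => i _; apply: eq_bigr => j _.
rewrite /cv (_ : (fun r => K r j i) = (fun r => K r i j))//.
by apply/funext => r; rewrite {1}K_sym mxE.
Qed.

Lemma lyapunov_derive (x : R) : is_derive x 1 lyapunov (dissipation (u x, u' x)).
Proof.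
have [_ dh] := svalP energy.
set m' := derive1 (fun y => grad_v E (u y) (u' y)) x.
have -> : dissipation (u x, u' x) =
    c^-1 *: ((((grad_u E (u x) (u' x) - m')^T *m u' x) 0 0) +
       2^-1 *: \sum_i \sum_j
    (w' x i 0 * cv i j j x +
     w' x j 0 * cv i j i x)).
  have tr1 (a b : 'cV[R]_d) : (a^T *m b) 0 0 = (b^T *m a) 0 0.
    by rewrite !trmx_mul_sum; apply: eq_bigr => i _; rewrite mulrC.
  have addE (A B : 'M[R]_1) : A 0 0 + B 0 0 = (A + B) 0 0 by rewrite mxE.
  rewrite [_ *: \sum_i _]w'_kap /w' trmx_mul -mulmxA tr1 addE -mulmxDr.
  rewrite (addrC (grad_u _ _ _)) (u_solution x) -scalemxAr mxE.
  by rewrite /dissipation/= -mulmxA /GRing.scale/= mulKf.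
apply: (@is_deriveZ _ _ _ (fun x => h (u x, u' x) + 2^-1 * \sum_i \sum_j N i j x) c^-1).
apply: (@is_deriveD _ _ _ (fun x => h (u x, u' x)) (fun x => 2^-1 * \sum_i \sum_j N i j x)).
apply: (@is_deriveZ _ _ _ (fun x => \sum_i \sum_j N i j x) 2^-1).
apply: (is_derive_sum_fun (h := fun i y => \sum_j N i j y)
  (h' := fun i x => \sum_j
    (w' x i 0 * cv i j j x +
     w' x j 0 * cv i j i x))) => i.
apply: (is_derive_sum_fun (h' := fun j x =>
    (w' x i 0 * cv i j j x +
     w' x j 0 * cv i j i x))) => j.
exact: dN.
Qed.

Lemma dissipation_ge0 p : 0 <= dissipation p.
Proof.
have [p20|p20] := eqVneq p.2 0; last exact/ltW/Gamma_posdef.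
by rewrite /dissipation p20 mulmx0 mxE.
Qed.

Lemma dissipation_continuous : continuous dissipation.
Proof.
have c1 : continuous (fun p : 'cV[R]_d * 'cV[R]_d => p.1) by move=> p; exact: cvg_fst.
have c2 : continuous (fun p : 'cV[R]_d * 'cV[R]_d => p.2) by move=> p; exact: cvg_snd.
have c3 : continuous (fun p : 'cV[R]_d * 'cV[R]_d => p.2^T *m Gamma p.1 *m p.2).
  apply: continuous_mulmx => //; apply: continuous_mulmx.
    exact: continuous_trmx.
  by move=> p; exact: (@continuous_comp _ _ _ fst Gamma p (c1 p) (@Gamma_continuous _)).
exact: (continuous_mxP _).1 c3 0 0.
Qed.

Lemma lyapunov_homo : {homo lyapunov : x y / x <= y}.
Proof.
by apply: derive_ge0_homo lyapunov_derive _ => x; exact: dissipation_ge0.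
Qed.

Lemma lyapunov_bounded : exists B, forall x, `|lyapunov x| <= B.
Proof.
have [ch _] := svalP energy.
have [B1 hB1] := bounded_comp_compact (@compact_cV_ball2 R d M) ch uu'.
have [B2 hB2] : exists B, forall x, `|\sum_i \sum_j N i j x| <= B.
  apply: bounded_sum => i; apply: bounded_sum => j.
  exists (C ^+ 2 * moment (fun r => K r i j)) => x.
  exact: (nonlocal_energy_bounded (C := C) (mK i j) (dwi i) (dwi j) (@cw'i j)).
exists (`|c^-1| * (B1 + 2^-1 * B2)) => x.
rewrite normrM ler_wpM2l// (le_trans (ler_normD _ _))// lerD//.
by rewrite normrM ger0_norm ?invr_ge0// ler_wpM2l ?invr_ge0.
Qed.

Let kap_unif_continuous : unif_continuous kap.
Proof.
have [B kapB] := kconv_lipschitz mK cw wC w_lip.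
exact: lipschitz_unif_continuous kapB.
Qed.

Lemma solution_top_unif_continuous : unif_continuous (derive1n (eq_order E) u).
Proof.
have [B kapB] := kconv_bounded mK cw wC.
have hM := svalP u_bound.
have kapM x : `|kap x| <= Num.max M B by rewrite le_max kapB orbT.
have uMB j (jk : (j <= eq_order E)%N) x : `|derive1n j u x| <= Num.max M B.
  by rewrite le_max hM.
exact: (top_derivative_unif_continuous E_nondegenerate E_smooth (proj1 u_CRb)
  c_neq0 Gamma_continuous (fun p => posdef_unitmx (Gamma_posdef p))
  (jac_continuous S_C1) kap_unif_continuous kapM uMB u_solution).
Qed.

Let u'_unif_continuous : unif_continuous u'.
Proof.
have [[k1 _]|[k2 _]] := eq_orderP E_nondegenerate.
  by have := solution_top_unif_continuous; rewrite k1.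
have k_gt1 : (1 < eq_order E)%N by rewrite k2.
have du1 := @curve_is_derive _ _ _ u 1 (proj1 u_CRb) k_gt1.
have hM : forall x, `|derive1n 2 u x| <= M := svalP u_bound 2%N k_gt1.
apply: lipschitz_unif_continuous; exact: (curve_lipschitz du1 hM).
Qed.

(** The dissipation is the uniformly continuous derivative of a convergent function,
    so it vanishes along the end, and it controls the velocity. *)
Lemma velocity_cvg0 (F : set_system R) (l : R) : ProperFilter F -> end_filter F ->
  lyapunov x @[x --> F] --> l -> u' x @[x --> F] --> (0 : 'cV[R]_d).
Proof.
move=> FF eF Vl.
apply: (@cvg0_of_positive _ F _ dissipation u u' M) => //.
- exact: dissipation_continuous.
- by move=> p p0; exact: Gamma_posdef.
- apply: barbalat FF eF lyapunov_derive _ Vl.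
  apply: (unif_continuous_comp_compact (@compact_cV_ball2 R d M)
    dissipation_continuous uu').
  apply: unif_continuous_pair => //.
  by apply: lipschitz_unif_continuous; exact: curve_lipschitz du u'M.
Qed.

Lemma derivatives_cvg0 (F : set_system R) (l : R) : ProperFilter F -> end_filter F ->
  lyapunov x @[x --> F] --> l ->
  forall j, (0 < j <= eq_order E)%N ->
    derive1n j u x @[x --> F] --> (0 : 'cV[R]_d).
Proof.
move=> FF eF Vl j; have u'0 := velocity_cvg0 FF eF Vl.
have := solution_top_unif_continuous.
have := @curve_is_derive _ _ _ u 1 (proj1 u_CRb).
have [[-> _] _ _|[-> _] du1 uc] := eq_orderP E_nondegenerate.
  by move=> jk; have -> : j = 1%N by case: j jk => [|[|]].
move=> j12; have [->|->] : j = 1%N \/ j = 2%N.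
  by case: j j12 => [|[|[|]]]//; [left|right].
  exact: u'0.
exact: (barbalat_mx FF eF (du1 isT) uc u'0).
Qed.

(** The value that the Lyapunov function takes on the constant curve [a]. *)
Definition lyapunov_limit (a : 'cV[R]_d) : R :=
  c^-1 * (h (a, 0) + 2^-1 * \sum_i \sum_j
    (\int[lebesgue_measure]_r (K r i j * (S a i 0 * S a j 0)))%R).

Lemma lyapunov_cvg (F : set_system R) (l : R) (tau : nat -> R) (a : 'cV[R]_d) :
  ProperFilter F -> end_filter F -> lyapunov x @[x --> F] --> l ->
  tau n @[n --> \oo] --> F ->
  (forall t, u (tau n + t) @[n --> \oo] --> a) ->
  lyapunov (tau n) @[n --> \oo] --> lyapunov_limit a.
Proof.
move=> FF eF Vl tauF ua; have u'0 := velocity_cvg0 FF eF Vl.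
have [ch _] := svalP energy.
have ua0 : u (tau n) @[n --> \oo] --> a.
  by have := ua 0; under eq_fun do rewrite addr0.
have u'tau : u' (tau n) @[n --> \oo] --> (0 : 'cV[R]_d).
  exact: (cvg_comp _ _ tauF u'0).
have w'0 : w' x @[x --> F] --> (0 : 'cV[R]_d).
  have [B JB] := jac_bound.
  apply/cvgrPdist_le => e e0.
  have B0 : 0 < d%:R * `|B| + 1 by rewrite ltr_wpDl// mulr_ge0.
  move/cvgrPdist_le : u'0 => /(_ _ (divr_gt0 e0 B0)); apply: filterS => x.
  rewrite !sub0r !normrN ler_pdivlMr// mulrDr mulr1 => h1.
  rewrite (le_trans (norm_mulmx_le _ _))//.
  have h2 : d%:R * `|jac S (u x)| * `|u' x| <= `|u' x| * (d%:R * `|B|).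
    rewrite mulrC ler_wpM2l// ler_wpM2l// (le_trans (JB x))//.
    exact: ler_norm.
  by rewrite (le_trans h2)// (le_trans _ h1)// lerDl.
have wa i t : w (tau n + t) i 0 @[n --> \oo] --> S a i 0.
  have h1 : S (u (tau n + t)) @[n --> \oo] --> S a.
    exact: (cvg_comp _ _ (ua t) (@Ck_continuous _ _ _ _ _ S_C1 a)).
  exact: (cvg_mxP _ _).1 h1 i 0.
apply: cvgM; first exact: cvg_cst.
apply: cvgD.
  exact: (cvg_comp _ _ (cvg_pair ua0 u'tau) (ch (a, 0))).
apply: cvgM; first exact: cvg_cst.
apply: cvg_sum_ord => i; apply: cvg_sum_ord => j.
apply: (nonlocal_energy_cvg (C := C) (mK i j) (dwi i) (dwi j) (@cw'i j)) => //.
move=> L e e0; have := end_cvg0_uniform L FF eF tauF w'0 e0.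
apply: filterS => n hn t tL; rewrite (le_trans (mx_norm_entry _ _ _))//.
by apply: ltW; exact: hn.
Qed.

Lemma end_limit_spec (F : set_system R) (l : R) :
  ProperFilter F -> end_filter F -> lyapunov x @[x --> F] --> l ->
  end_limit F (eq_order E) u !=set0 /\
  end_limit F (eq_order E) u `<=` constant_curve.
Proof.
move=> FF eF Vl; split.
  exact: (end_limit_nonempty FF eF order_gt0 uM du (derivatives_cvg0 FF eF Vl)).
exact: (end_limit_constant FF eF order_gt0 (velocity_cvg0 FF eF Vl)).
Qed.

Lemma lyapunov_cvg_end_limit (F : set_system R) (l : R) g (a : 'cV[R]_d) :
  ProperFilter F -> end_filter F -> lyapunov x @[x --> F] --> l ->
  end_limit F (eq_order E) u g -> (forall x, g x = a) -> l = lyapunov_limit a.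
Proof.
move=> FF eF Vl [_ [tau [tauF ug]]] ga.
have ua t : u (tau n + t) @[n --> \oo] --> a.
  rewrite (_ : (fun n => _) = fun n => derive1n 0 (phi (tau n) u) t).
    by rewrite -(ga t); exact: cvg_Ckloc_pointwise ug (leq0n _).
  by apply/funext => n; rewrite derive1n0 /phi addrC.
have h1 := lyapunov_cvg FF eF Vl tauF ua.
have h2 : lyapunov (tau n) @[n --> \oo] --> l := cvg_comp _ _ tauF Vl.
exact: (@cvg_unique _ (@norm_hausdorff R R^o) _ _ _ _ h2 h1).
Qed.

(** A common limit [a] forces the two limits of the Lyapunov function to agree, so
    that, being monotone, it is constant and nothing is dissipated. *)
Lemma homoclinic_constant (lp lm : R) g :
  lyapunov x @[x --> +oo] --> lp -> lyapunov x @[x --> -oo] --> lm ->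
  end_limit -oo (eq_order E) u g -> end_limit +oo (eq_order E) u g ->
  constant_curve u.
Proof.
move=> Vp Vm gm gp.
have [_ /(_ g gp)[a ga]] := end_limit_spec _ (@end_filter_pinfty R) Vp.
have lpE := lyapunov_cvg_end_limit _ (@end_filter_pinfty R) Vp gp ga.
have lmE := lyapunov_cvg_end_limit _ (@end_filter_ninfty R) Vm gm ga.
have Vge x : lm <= lyapunov x.
  apply: (cvgr_to_le Vm); exists x; split; first exact: num_real.
  by move=> y /ltW; exact: lyapunov_homo.
have Vle x : lyapunov x <= lp.
  apply: (cvgr_to_ge Vp); exists x; split; first exact: num_real.
  by move=> y /ltW; exact: lyapunov_homo.
have VE : lyapunov = cst lm.
  by apply/funext => x; apply/le_anti; rewrite Vge lmE -lpE Vle.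
apply: (derive_zero_constant du) => x; apply/eqP/negPn/negP => u'x.
have := Gamma_posdef (u x) u'x.
have [_ dV] := lyapunov_derive x; rewrite VE derive_cst in dV.
by rewrite -[X in 0 < X]/(dissipation (u x, u' x)) -dV ltxx.
Qed.

End solution.

Unset Implicit Arguments.

Theorem theorem4p3 (R : realType) (d : nat)
  (K : R -> 'M[R]_d) (S : 'cV[R]_d -> 'cV[R]_d)
  (E : 'cV[R]_d -> 'cV[R]_d -> R) (Gamma : 'cV[R]_d -> 'M[R]_d)
  (c : R) (u : R -> 'cV[R]_d)
  (K_even : forall r, K r = K (- r))
  (K_sym : forall r, K r = (K r)^T)
  (K_L1 : forall i j,
     lebesgue_measure.-integrable setT (fun r => (K r i j)%:E))
  (K_moment :
     (\int[lebesgue_measure]_r ((1 + `|r|) * `|K r|)%:E < +oo)%E)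
  (S_C2 : Ck 2 S)
  (E_C2 : Ck 2 (fun p : 'cV[R]_d * 'cV[R]_d => E p.1 p.2))
  (Gamma_continuous : continuous Gamma)
  (Gamma_bounded : exists M : R, forall w, `|Gamma w| <= M)
  (Gamma_posdef : forall w, posdef (Gamma w))
  (c_neq0 : c != 0)
  (E_smooth : Ck (eq_order E).+1 (fun p : 'cV[R]_d * 'cV[R]_d => E p.1 p.2))
  (S_smooth : Ck (eq_order E).+1 S)
  (E_nondegenerate :
     (forall w v, grad_v E w v = 0) \/
     (forall w v, hess_v E w v \in unitmx))
  (u_CRb : Ckb_curve (eq_order E) u)
  (u_bounded : Ckb_curve (eq_order E).-1 u)
  (u_solution : forall x,
     - derive1 (fun y => grad_v E (u y) (derive1 u y)) x
       + grad_u E (u x) (derive1 u x)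
       + (jac S (u x))^T *m kconv K (S \o u) x
     = c *: (Gamma (u x) *m derive1 u x)) :
  (alpha_limit (eq_order E) u !=set0 /\
   alpha_limit (eq_order E) u `<=` constant_curve) /\
  (omega_limit (eq_order E) u !=set0 /\
   omega_limit (eq_order E) u `<=` constant_curve) /\
  (~ constant_curve u ->
   alpha_limit (eq_order E) u `&` omega_limit (eq_order E) u = set0).
Proof.
have mK := finite_moment_entry K_L1 K_moment.
have S_C1 : Ck 1 S := CkW S_C2.
have [B VB] := lyapunov_bounded c mK S_C1 E_smooth E_nondegenerate u_CRb.
have homoV := lyapunov_homo K_even K_sym mK S_C1 Gamma_posdef c_neq0
  E_smooth E_nondegenerate u_CRb u_solution.
have [[lp Vp] [lm Vm]] := homo_bounded_cvg homoV VB.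
split; last split.
- exact: (end_limit_spec K_even K_sym mK Gamma_continuous Gamma_posdef c_neq0
    u_solution _ (@end_filter_ninfty R) Vm).
- exact: (end_limit_spec K_even K_sym mK Gamma_continuous Gamma_posdef c_neq0
    u_solution _ (@end_filter_pinfty R) Vp).
- move=> nconst; apply/seteqP; split=> // g [gm gp]; apply: nconst.
  exact: (homoclinic_constant K_even K_sym mK Gamma_continuous Gamma_posdef c_neq0
    u_solution Vp Vm gm gp).
Qed.
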